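(* For $t$ a (complex) number that is not an integer, and integer $p\ge 1$, define $$T(t,p)=\frac{(-1)^{p-1}}{2(p-1)!}\left(\psi^{(p)}(t)-2\gamma\,\psi^{(p-1)}(t)-\sum_{k=0}^{p-1}\binom{p-1}{k}\psi^{(k)}(t)\,\psi^{(p-1-k)}(t)\right).$$ Then, for every integer $p\ge 2$ and every such $t$, $$\sum_{k=1}^\infty\frac{H_k}{(k+t)^p}=T(t,p).$$
   Context: $H_k = 1+1/2+\cdots+1/k$ is the $k$th harmonic number. $\gamma$ is Euler's constant. $\psi(z)=\Gamma'(z)/\Gamma(z)$ is the digamma function (meromorphic on $\mathbb C$), and $\psi^{(n)}$ denotes its $n$-th derivative, with $\psi^{(0)}=\psi$. *)

(* Defs.v *)
From Stdlib Require Export Reals Factorial.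
From Coquelicot Require Export Coquelicot.

Local Open Scope C_scope.

Definition harmonic (k : nat) : R := sum_n_m (fun i => / INR i)%R 1 k.

Definition euler_gamma : R :=
  real (Lim_seq (fun n => harmonic n - ln (INR n))%R).

Definition Cexp (z : C) : C :=
  RtoC (exp (Re z)) * (cos (Im z), sin (Im z)).

(* z (z + 1) ... (z + n - 1) *)
Fixpoint rising (z : C) (n : nat) : C :=
  match n with
  | O => 1
  | S m => rising z m * (z + RtoC (INR m))
  end.

(* n! n^z / (z (z + 1) ... (z + n)), with n^z = exp (z ln n). *)
Definition gauss_seq (z : C) (n : nat) : C :=
  RtoC (INR (fact n)) * Cexp (z * RtoC (ln (INR n))) / rising z (S n).

(* Euler's limit formula, valid on the whole of C minus the non-positive
   integers (the poles, where the value below is meaningless). The limit is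
   taken componentwise, as in Coquelicot's C_lim. *)
Definition Gamma (z : C) : C :=
  (real (Lim_seq (fun n => Re (gauss_seq z n))),
   real (Lim_seq (fun n => Im (gauss_seq z n)))).

Definition digamma (z : C) : C := C_derive Gamma z / Gamma z.

Definition polygamma (n : nat) : C -> C := Nat.iter n C_derive digamma.

(* Intended for 1 <= p only: p - 1 is truncated subtraction. Binomial.C is the
   binomial coefficient, and sum_n f m is f 0 + ... + f m. *)
Definition T (t : C) (p : nat) : C :=
  RtoC ((-1) ^ (p - 1) / (2 * INR (fact (p - 1)))) *
  (polygamma p t
   - RtoC (2 * euler_gamma) * polygamma (p - 1) t
   - sum_n (G := C_AbelianGroup)
       (fun k => RtoC (Binomial.C (p - 1) k) *
                 polygamma k t * polygamma (p - 1 - k) t)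
       (p - 1)).

(* Main.v *)
Require Import Defs.
From Stdlib Require Import Reals Lra Lia.
From Coquelicot Require Import Coquelicot.

(* Write a_n = 1/(t+n) and S_q = sum_n a_n^q. Since
   a_n - a_m = (m-n) a_n a_m, a geometric sum gives, for n <> m,
     sum_(k<p) a_n^(k+1) a_m^(p-k) = (a_n^p - a_m^p) / (m-n).
   Summing over n, m <= N and using sum_(m<=N) 1/(m-n) = H_(N-n) - H_n (without
   the term m = n) expresses sum_(n<=N) H_n a_n^p through truncated sums S_q, up
   to the remainder sum_(n<=N) (H_N - H_(N-n)) a_n^p, which is O(H_N / N). The
   convolution of truncated S_q is the convolution of polygamma values in T,
   because polygamma k = (-1)^(k+1) k! S_(k+1) for k >= 1 and
   digamma t = lim (ln N - sum_(n<=N) a_n).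

   The last two facts are obtained without Cauchy's theory: every function
   involved is a pointwise limit of explicit functions F_n with
   |F_n(z+h) - F_n(z) - h G_n| <= M |h|^2 uniformly in n, an estimate that
   passes to the limit. *)

Local Open Scope C_scope.

(** * Limits and sums of complex sequences *)

(** The convolution in [T] contains the digamma function itself, whose sum S_1 diverges, so the
    double sums cannot be rearranged in the limit. Hence everything is cut at one common N, Euler's
    constant included, which enters as H_N - ln N. All sums are then finite, the identity with its
    remainder is exact for each N, and the logarithms cancel before N grows. Indices start at 0 to
    match the polygamma sums; on the harmonic side this is harmless because H_0 = 0.

    On the analytic side, [Lim_seq] and [C_derive] are total operators, whose values mean something
    only once convergence or differentiability is known. Convergence always comes from steps of size
    O(1/n^2), additive for sums and relative for the Gauss product; the terms of order 1/n cancel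
    because ln (n+1) - ln n is 1/(n+1) up to O(1/n^2). *)

Definition Clim (u : nat -> C) (l : C) : Prop :=
  is_lim_seq (fun n => Cmod (u n - l)) 0.

Lemma Clim_squeeze (u : nat -> C) (l : C) (e : nat -> R) :
  (forall n, Cmod (u n - l) <= e n)%R -> is_lim_seq e 0 -> Clim u l.
Proof.
intros H He.
apply (is_lim_seq_le_le (fun _ => 0%R) _ e); trivial.
- intros n; split; trivial; apply Cmod_ge_0.
- apply is_lim_seq_const.
Qed.

Lemma Clim_ext (u v : nat -> C) (l : C) :
  (forall n, u n = v n) -> Clim u l -> Clim v l.
Proof.
intros H; apply is_lim_seq_ext; intros n; now rewrite H.
Qed.

Lemma Clim_const (c : C) : Clim (fun _ => c) c.
Proof.
apply (Clim_squeeze _ _ (fun _ => 0%R)); [|apply is_lim_seq_const].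
intros n; replace (c - c) with (RtoC 0) by ring; rewrite Cmod_0; lra.
Qed.

Lemma Clim_incr_1 (u : nat -> C) (l : C) :
  Clim u l -> Clim (fun n => u (S n)) l.
Proof. intros H; apply (is_lim_seq_incr_1 _ _) in H; exact H. Qed.

Lemma Clim_plus (u v : nat -> C) (l m : C) :
  Clim u l -> Clim v m -> Clim (fun n => u n + v n) (l + m).
Proof.
intros Hu Hv.
apply (Clim_squeeze _ _ (fun n => Cmod (u n - l) + Cmod (v n - m))%R).
- intros n; replace (u n + v n - (l + m)) with ((u n - l) + (v n - m)) by ring.
  apply Cmod_triangle.
- replace 0%R with (0 + 0)%R by ring; now apply is_lim_seq_plus'.
Qed.

Lemma Clim_mult (u v : nat -> C) (l m : C) :
  Clim u l -> Clim v m -> Clim (fun n => u n * v n) (l * m).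
Proof.
intros Hu Hv.
apply (Clim_squeeze _ _ (fun n => Cmod (u n - l) * Cmod (v n - m) +
  (Cmod l * Cmod (v n - m) + Cmod (u n - l) * Cmod m))%R).
- intros n.
  replace (u n * v n - l * m) with
    ((u n - l) * (v n - m) + (l * (v n - m) + (u n - l) * m)) by ring.
  rewrite <- !Cmod_mult.
  eapply Rle_trans; [apply Cmod_triangle|].
  apply Rplus_le_compat_l, Cmod_triangle.
- replace 0%R with (0 * 0 + (Cmod l * 0 + 0 * Cmod m))%R by ring.
  apply is_lim_seq_plus'; [now apply is_lim_seq_mult'|].
  apply is_lim_seq_plus'; apply is_lim_seq_mult'; trivial;
    apply is_lim_seq_const.
Qed.

Lemma Clim_scal (c : C) (u : nat -> C) (l : C) :
  Clim u l -> Clim (fun n => c * u n) (c * l).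
Proof. intros H; apply Clim_mult; trivial; apply Clim_const. Qed.

Lemma Clim_minus (u v : nat -> C) (l m : C) :
  Clim u l -> Clim v m -> Clim (fun n => u n - v n) (l - m).
Proof.
intros Hu Hv; apply (Clim_ext (fun n => u n + (- (1)) * v n)).
- intros n; ring.
- replace (l - m) with (l + (- (1)) * m) by ring.
  apply Clim_plus; trivial; now apply Clim_scal.
Qed.

Lemma Clim_Cmod_le (u : nat -> C) (l : C) (M : R) :
  Clim u l -> (forall n, Cmod (u n) <= M)%R -> (Cmod l <= M)%R.
Proof.
intros H HM.
cut (Rbar_le (Cmod l - 0)%R M); [simpl; lra|].
apply (is_lim_seq_le (fun n => Cmod l - Cmod (u n - l))%R (fun _ => M)).
- intros n; specialize (HM n).
  pose proof (Cmod_triangle (u n) (- (u n - l))) as T.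
  rewrite Cmod_opp in T.
  replace (u n + - (u n - l)) with l in T by ring; lra.
- apply is_lim_seq_minus'; trivial; apply is_lim_seq_const.
- apply is_lim_seq_const.
Qed.
 
Lemma Clim_unique (u : nat -> C) (l m : C) : Clim u l -> Clim u m -> l = m.
Proof.
intros Hl Hm.
assert (H := Clim_minus _ _ _ _ Hl Hm).
assert (H0 : (Cmod (l - m) <= 0)%R).
{ apply (Clim_Cmod_le (fun n => u n - u n)); trivial.
  intros n; replace (u n - u n) with (RtoC 0) by ring; rewrite Cmod_0; lra. }
apply Ceq_minus, Cmod_eq_0, Rle_antisym; trivial; apply Cmod_ge_0.
Qed.

(** Connects [Clim] with the componentwise limits by which [Gamma] is defined; both components are
    additive and bounded by the modulus. *)
Lemma Clim_Re_Im (u : nat -> C) (l : C) : Clim u l ->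
  is_lim_seq (fun n => Re (u n)) (Re l) /\
  is_lim_seq (fun n => Im (u n)) (Im l).
Proof.
intros H.
assert (K : forall f : C -> R, (forall z w, (f z - f w)%R = f (z - w)) ->
  (forall z, Rabs (f z) <= Cmod z)%R -> is_lim_seq (fun n => f (u n)) (f l)).
{ intros f Hf Hb.
  apply (is_lim_seq_ext (fun n => (f (u n) - f l) + f l)%R); [intros; ring|].
  replace (Finite (f l)) with (Finite (0 + f l)) by (f_equal; ring).
  apply is_lim_seq_plus'; [|apply is_lim_seq_const].
  apply is_lim_seq_abs_0.
  apply (is_lim_seq_le_le (fun _ => 0%R) _ (fun n => Cmod (u n - l))); trivial.
  - intros n; split; [apply Rabs_pos|]; rewrite Hf; apply Hb.
  - apply is_lim_seq_const. }
split; apply K.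
- intros z w; reflexivity.
- intros z; apply re_le_Cmod.
- intros z w; reflexivity.
- intros z; eapply Rle_trans; [|apply Rmax_Cmod]; apply Rmax_r.
Qed.

(** Fixes the group structure once, so that the rules below speak of the [+] and [*] of C that
    [ring] recognises. *)
Definition csum (a : nat -> C) (n : nat) : C := sum_n (G := C_AbelianGroup) a n.

Lemma csum_0 (a : nat -> C) : csum a 0 = a 0%nat.
Proof. exact (sum_O (G := C_AbelianGroup) a). Qed.

Lemma csum_ext (a b : nat -> C) (n : nat) :
  (forall k, (k <= n)%nat -> a k = b k) -> csum a n = csum b n.
Proof. exact (sum_n_ext_loc (G := C_AbelianGroup) a b n). Qed.

Lemma csum_switch (a : nat -> nat -> C) (m n : nat) :
  csum (fun i => csum (fun j => a i j) n) m =
  csum (fun j => csum (fun i => a i j) m) n.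
Proof. exact (sum_n_switch (G := C_AbelianGroup) a m n). Qed.

Lemma csum_S (a : nat -> C) (n : nat) : csum a (S n) = csum a n + a (S n).
Proof. exact (sum_Sn (G := C_AbelianGroup) a n). Qed.

Lemma csum_plus (a b : nat -> C) (n : nat) :
  csum (fun k => a k + b k) n = csum a n + csum b n.
Proof. exact (sum_n_plus (G := C_AbelianGroup) a b n). Qed.

Lemma csum_scal (c : C) (a : nat -> C) (n : nat) :
  csum (fun k => c * a k) n = c * csum a n.
Proof. exact (sum_n_mult_l (K := C_Ring) c a n). Qed.

Lemma csum_scal_r (c : C) (a : nat -> C) (n : nat) :
  csum (fun k => a k * c) n = csum a n * c.
Proof. exact (sum_n_mult_r (K := C_Ring) c a n). Qed.

Lemma csum_minus (a b : nat -> C) (n : nat) :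
  csum (fun k => a k - b k) n = csum a n - csum b n.
Proof.
induction n as [|n IH]; [now rewrite ?csum_0, ?sum_O|].
rewrite !csum_S, IH; ring.
Qed.

Lemma csum_delta (a : nat -> C) (j n : nat) : (j <= n)%nat ->
  csum (fun k => if Nat.eqb k j then a k else 0) n = a j.
Proof.
assert (Z : forall n, (n < j)%nat ->
  csum (fun k => if Nat.eqb k j then a k else 0) n = 0).
{ intros m; induction m as [|m IH]; intros Hm.
  - rewrite csum_0; destruct (Nat.eqb_spec 0 j); trivial; lia.
  - rewrite csum_S, IH by lia.
    destruct (Nat.eqb_spec (S m) j); [lia|]; ring. }
induction n as [|n IH]; intros H.
- rewrite csum_0; destruct (Nat.eqb_spec 0 j); [now subst|lia].
- rewrite csum_S; destruct (Nat.eqb_spec (S n) j).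
  + rewrite Z by lia; subst; ring.
  + rewrite IH by lia; ring.
Qed.

Lemma csum_RtoC (f : nat -> R) (n : nat) :
  csum (fun k => RtoC (f k)) n = RtoC (sum_n f n).
Proof.
induction n as [|n IH]; [now rewrite ?csum_0, ?sum_O|].
rewrite csum_S, sum_Sn, IH, <- RtoC_plus; reflexivity.
Qed.

Lemma Cmod_csum_le (a : nat -> C) (b : nat -> R) (n : nat) :
  (forall k, (k <= n)%nat -> Cmod (a k) <= b k)%R ->
  (Cmod (csum a n) <= sum_n b n)%R.
Proof.
induction n as [|n IH]; intros H.
- rewrite csum_0, sum_O; now apply H.
- rewrite csum_S, sum_Sn.
  eapply Rle_trans; [apply Cmod_triangle|].
  apply Rplus_le_compat; [apply IH; intros; apply H; lia|now apply H].
Qed.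

Lemma Clim_csum (a : nat -> nat -> C) (l : nat -> C) (n : nat) :
  (forall k, (k <= n)%nat -> Clim (fun N => a N k) (l k)) ->
  Clim (fun N => csum (a N) n) (csum l n).
Proof.
induction n as [|n IH]; intros H.
- rewrite csum_0; apply (Clim_ext (fun N => a N 0%nat));
    [intros; now rewrite csum_0|now apply H].
- rewrite csum_S; apply (Clim_ext (fun N => csum (a N) n + a N (S n)));
    [intros; now rewrite csum_S|].
  apply Clim_plus; [apply IH; intros; apply H; lia|now apply H].
Qed.

Lemma is_series_Clim (a : nat -> C) (l : C) :
  Clim (csum a) l -> is_series (K := C_AbsRing) (V := C_NormedModule) a l.
Proof.
intros H P HP.
apply locally_norm_le_locally in HP.
destruct HP as [eps He].
apply is_lim_seq_spec in H; destruct (H eps) as [N HN].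
exists N; intros n Hn; apply He; red.
specialize (HN n Hn); rewrite Rminus_0_r, Rabs_pos_eq in HN by apply Cmod_ge_0.
exact HN.
Qed.

Lemma Clim_is_series (a : nat -> C) (l : C) :
  is_series (K := C_AbsRing) (V := C_NormedModule) a l -> Clim (csum a) l.
Proof.
intros H; apply is_lim_seq_spec; intros eps.
specialize (H _ (locally_le_locally_norm (V := C_NormedModule) l _
  (locally_norm_ball_norm (V := C_NormedModule) l eps))).
destruct H as [N HN]; exists N; intros n Hn.
specialize (HN n Hn).
rewrite Rminus_0_r, Rabs_pos_eq by apply Cmod_ge_0; exact HN.
Qed.

(** * Sequences with steps of order 1/n^2 *)

Lemma INR_S_pos (n : nat) : (0 < INR (S n))%R.
Proof. apply lt_0_INR; lia. Qed.

Lemma inv_INR_S (n : nat) : (0 < / INR (S n) <= 1)%R.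
Proof.
split; [apply Rinv_0_lt_compat, INR_S_pos|].
rewrite <- Rinv_1; apply Rinv_le_contravar; [lra|].
apply (le_INR 1); lia.
Qed.

(** Since x + 1 <= 2x for x >= 1, 1/x^2 <= 2/(x(x+1)). Sums of 1/(n+1)^2 thereby telescope to at
    most 2, the source of the factors 2 below. *)
Lemma inv_sq_telescope (n : nat) :
  ((/ INR (S n)) ^ 2 <= 2 * (/ INR (S n) - / INR (S (S n))))%R.
Proof.
pose proof (INR_S_pos n); pose proof (le_INR 1 (S n) ltac:(lia)) as H1.
simpl (INR 1) in H1; rewrite (S_INR (S n)).
set (x := INR (S n)) in *.
replace (2 * (/ x - / (x + 1)))%R with (2 * / (x * (x + 1)))%R by (field; lra).
replace ((/ x) ^ 2)%R with (2 * / (x * (2 * x)))%R by (field; lra).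
apply Rmult_le_compat_l; [lra|].
apply Rinv_le_contravar; nra.
Qed.

(** The bound is explicit and linear in [c]: later [c] carries a power of |h|, and the conclusion
    becomes an estimate in h uniform in n. *)
Lemma bounded_of_inv_sq_steps (u : nat -> C) (c : R) :
  (forall n, Cmod (u (S n) - u n) <= c * (/ INR (S n)) ^ 2)%R ->
  forall n, (Cmod (u n - u 0%nat) <= 2 * c)%R.
Proof.
intros H n.
assert (Hc : (0 <= c)%R).
{ specialize (H 0%nat); pose proof (Cmod_ge_0 (u 1%nat - u 0%nat)).
  simpl in H; rewrite Rinv_1 in H; lra. }
(* Strengthened by the unspent part of the telescoping sum; the bound 2c alone is not inductive. *)
assert (K : (Cmod (u n - u 0%nat) <= 2 * c * (1 - / INR (S n)))%R).
{ induction n as [|n IH].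
  - replace (u 0%nat - u 0%nat) with (RtoC 0) by ring.
    rewrite Cmod_0; simpl; lra.
  - replace (u (S n) - u 0%nat) with ((u (S n) - u n) + (u n - u 0%nat)) by ring.
    eapply Rle_trans; [apply Cmod_triangle|].
    specialize (H n); pose proof (inv_sq_telescope n); nra. }
pose proof (inv_INR_S n); nra.
Qed.

Lemma ex_series_inv_sq : ex_series (fun n => (/ INR (S n)) ^ 2)%R.
Proof.
assert (B : forall n, (sum_n (fun k => (/ INR (S k)) ^ 2) n
  <= 2 * (1 - / INR (S (S n))))%R).
{ induction n as [|n IH].
  - rewrite sum_O; pose proof (inv_sq_telescope 0).
    replace (/ INR 1)%R with 1%R in * by (simpl; field); exact H.
  - rewrite sum_Sn; pose proof (inv_sq_telescope (S n)).
    change plus with Rplus; lra. }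
destruct (ex_finite_lim_seq_incr
  (sum_n (fun k => (/ INR (S k)) ^ 2)%R) 2) as [l Hl].
- intros n; rewrite sum_Sn; change plus with Rplus.
  pose proof (pow2_ge_0 (/ INR (S (S n)))); lra.
- intros n; specialize (B n); pose proof (inv_INR_S (S n)); lra.
- exists l; exact Hl.
Qed.

Lemma Clim_of_inv_sq_steps (u : nat -> C) (c : R) :
  (forall n, Cmod (u (S n) - u n) <= c * (/ INR (S n)) ^ 2)%R ->
  exists l : C, Clim u l.
Proof.
intros H.
destruct (ex_series_le (K := C_AbsRing) (V := C_CompleteNormedModule)
  (fun n => u (S n) - u n) (fun n => c * (/ INR (S n)) ^ 2)%R) as [l Hl].
- exact H.
- apply (ex_series_scal (K := R_AbsRing) (V := R_NormedModule) c),
    ex_series_inv_sq.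
- apply Clim_is_series in Hl.
  exists (l + u 0%nat).
  assert (K : Clim (fun n => u (S n)) (l + u 0%nat)).
  { apply (Clim_ext (fun n => csum (fun n => u (S n) - u n) n + u 0%nat)).
    - intros n; induction n as [|n IH]; [rewrite csum_0; ring|].
      rewrite csum_S, <- IH; ring [IH].
    - apply Clim_plus; trivial; apply Clim_const. }
  unfold Clim in *; now apply is_lim_seq_incr_1.
Qed.

Lemma exp_le_compat (x y : R) : (x <= y -> exp x <= exp y)%R.
Proof.
intros [H|H]; [left; now apply exp_increasing|right; now rewrite H].
Qed.

(** A discrete Gronwall inequality: each step multiplies the modulus by at most 1 + x <= exp x, and
    the exponents telescope. *)
Lemma Cmod_le_of_ratio_steps (u : nat -> C) (c : R) :
  (forall n, Cmod (u (S n) - u n) <= c * (/ INR (S n)) ^ 2 * Cmod (u n))%R ->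
  (0 <= c)%R ->
  forall n, (Cmod (u n) <= Cmod (u 0%nat) * exp (2 * c))%R.
Proof.
intros H Hc n.
assert (K : (Cmod (u n) <= Cmod (u 0%nat) * exp (2 * c * (1 - / INR (S n))))%R).
{ induction n as [|n IH].
  - simpl; rewrite Rinv_1, Rminus_diag, Rmult_0_r, exp_0; lra.
  - replace (u (S n)) with ((u (S n) - u n) + u n) by ring.
    eapply Rle_trans; [apply Cmod_triangle|].
    apply Rle_trans with
      (Cmod (u n) * (1 + 2 * c * (/ INR (S n) - / INR (S (S n)))))%R.
    + specialize (H n); pose proof (inv_sq_telescope n) as Q.
      pose proof (Cmod_ge_0 (u n)).
      assert (c * (/ INR (S n)) ^ 2 * Cmod (u n) <=
        c * (2 * (/ INR (S n) - / INR (S (S n)))) * Cmod (u n))%R.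
      { apply Rmult_le_compat_r; trivial; now apply Rmult_le_compat_l. }
      lra.
    + replace (2 * c * (1 - / INR (S (S n))))%R with
        (2 * c * (1 - / INR (S n)) +
         2 * c * (/ INR (S n) - / INR (S (S n))))%R by ring.
      rewrite exp_plus, <- Rmult_assoc.
      apply Rmult_le_compat; trivial; [apply Cmod_ge_0| |apply exp_ineq1_le].
      pose proof (inv_sq_telescope n); pose proof (pow2_ge_0 (/ INR (S n))).
      nra. }
eapply Rle_trans; [exact K|].
apply Rmult_le_compat_l; [apply Cmod_ge_0|].
pose proof (inv_INR_S n); apply exp_le_compat; nra.
Qed.

Lemma Clim_of_ratio_steps (u : nat -> C) (c : R) :
  (forall n, Cmod (u (S n) - u n) <= c * (/ INR (S n)) ^ 2 * Cmod (u n))%R ->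
  (0 <= c)%R -> exists l : C, Clim u l.
Proof.
intros H Hc.
pose proof (Cmod_le_of_ratio_steps u c H Hc) as B.
apply (Clim_of_inv_sq_steps u (c * (Cmod (u 0%nat) * exp (2 * c)))).
intros n; eapply Rle_trans; [apply H|].
rewrite (Rmult_comm (c * (Cmod _ * _))), (Rmult_comm c), Rmult_assoc.
apply Rmult_le_compat_l; [apply pow2_ge_0|].
now apply Rmult_le_compat_l.
Qed.

(* Passing a second-order estimate uniform in [n] to the limit: no interchange
   of limits is needed. *)
Lemma is_derive_of_Clim (f : C -> C) (F : nat -> C -> C) (G : nat -> C)
    (z g : C) (r M : R) :
  (0 < r)%R ->
  (forall h, (Cmod h < r)%R -> Clim (fun n => F n (z + h)) (f (z + h))) ->
  Clim G g ->
  (forall n h, (Cmod h < r)%R ->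
    Cmod (F n (z + h)%C - F n z - h * G n) <= M * Cmod h ^ 2)%R ->
  is_derive (K := C_AbsRing) (V := C_NormedModule) f z g.
Proof.
intros Hr HF HG HM.
assert (Q : forall h, (Cmod h < r)%R ->
  (Cmod (f (z + h)%C - f z - h * g) <= M * Cmod h ^ 2)%R).
{ intros h Hh.
  apply (Clim_Cmod_le (fun n => F n (z + h)%C - F n z - h * G n));
    [|intros n; now apply HM].
  apply Clim_minus; [apply Clim_minus|now apply Clim_scal]; [now apply HF|].
  assert (H0 := HF 0%C ltac:(now rewrite Cmod_0)).
  replace (z + 0) with z in H0 by ring; exact H0. }
split; [apply is_linear_scal_l|].
intros x Hx eps.
apply (is_filter_lim_locally_unique (V := AbsRing_NormedModule C_AbsRing)) in Hx.
subst x.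
(* Within this radius M |h|^2 <= eps |h|; the denominator stays positive even when [M] is zero or
   negative. *)
assert (Hd : (0 < Rmin r (eps / (Rabs M + 1)))%R).
{ apply Rmin_pos; trivial; apply Rdiv_lt_0_compat;
    [apply cond_pos|pose proof (Rabs_pos M); lra]. }
exists (mkposreal _ Hd); intros y Hy.
change (Cmod (y - z) < Rmin r (eps / (Rabs M + 1)))%R in Hy.
change (Cmod (f y - f z - (y - z) * g) <= eps * Cmod (y - z))%R.
set (h := y - z) in *.
replace y with (z + h) by (unfold h; ring).
eapply Rle_trans; [apply Q; eapply Rlt_le_trans; [apply Hy|apply Rmin_l]|].
assert (Hh : (Cmod h < eps / (Rabs M + 1))%R)
  by (eapply Rlt_le_trans; [apply Hy|apply Rmin_r]).
pose proof (Rabs_pos M) as M0; pose proof (Rle_abs M) as M1.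
apply (Rmult_lt_compat_r (Rabs M + 1)) in Hh; [|lra].
replace (eps / (Rabs M + 1) * (Rabs M + 1))%R with (pos eps) in Hh
  by (field; lra).
pose proof (Cmod_ge_0 h).
replace (M * Cmod h ^ 2)%R with (M * Cmod h * Cmod h)%R by ring.
apply Rmult_le_compat_r; trivial; nra.
Qed.

(** * Gamma and polygamma functions as limits *)

Lemma Cexp_plus (z w : C) : Cexp (z + w) = Cexp z * Cexp w.
Proof.
destruct z as [a b], w as [c d]; unfold Cexp, Re, Im; simpl.
rewrite exp_plus, cos_plus, sin_plus.
apply injective_projections; simpl; ring.
Qed.

Lemma Cexp_0 : Cexp 0 = 1.
Proof.
unfold Cexp; simpl; rewrite exp_0, cos_0, sin_0.
apply Cmult_1_l.
Qed.

Lemma Cexp_nz (z : C) : Cexp z <> 0.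
Proof.
intros H; apply C1_nz.
rewrite <- Cexp_0; replace (RtoC 0) with (z + - z) by ring.
rewrite Cexp_plus, H; ring.
Qed.

(** Only 1 + x <= exp x is used, at x and at -x: the latter, multiplied by exp x, reads exp x - 1 <=
    x exp x. The next lemma subtracts x from this. *)
Lemma exp_minus_1_bound (x : R) : (Rabs (exp x - 1) <= Rabs x * exp (Rabs x))%R.
Proof.
pose proof (exp_ineq1_le x); pose proof (exp_ineq1_le (- x)) as H1.
pose proof (exp_pos x).
assert (E : (exp (- x) * exp x = 1)%R)
  by (rewrite <- exp_plus, Rplus_opp_l; apply exp_0).
assert ((1 - x) * exp x <= 1)%R by nra.
destruct (Rle_dec 0 x).
- rewrite (Rabs_pos_eq x), Rabs_pos_eq by lra; lra.
- rewrite (Rabs_left x) by lra.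
  pose proof (exp_ineq1_le (- x)).
  apply Rabs_le; nra.
Qed.

Lemma exp_minus_1_minus_id_bound (x : R) :
  (Rabs (exp x - 1 - x) <= x ^ 2 * exp (Rabs x))%R.
Proof.
pose proof (exp_ineq1_le x); pose proof (exp_ineq1_le (- x)) as H1.
pose proof (exp_pos x).
assert (E : (exp (- x) * exp x = 1)%R)
  by (rewrite <- exp_plus, Rplus_opp_l; apply exp_0).
assert ((1 - x) * exp x <= 1)%R by nra.
rewrite Rabs_pos_eq by lra.
apply Rle_trans with (x * (exp x - 1))%R; [lra|].
eapply Rle_trans; [apply Rle_abs|].
rewrite Rabs_mult.
replace (x ^ 2)%R with (Rabs x * Rabs x)%R
  by (rewrite <- Rabs_mult, Rabs_pos_eq; [ring|nra]).
rewrite Rmult_assoc; apply Rmult_le_compat_l; [apply Rabs_pos|].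
apply exp_minus_1_bound.
Qed.

Lemma abs_sin_le (y : R) : (Rabs (sin y) <= Rabs y)%R.
Proof.
destruct (MVT_gen sin 0 y cos) as [c [_ H]].
- intros; auto_derive; trivial; ring.
- intros; apply continuity_sin.
- rewrite sin_0, !Rminus_0_r in H; rewrite H, Rabs_mult.
  pose proof (COS_bound c); pose proof (Rabs_pos y).
  assert (Rabs (cos c) <= 1)%R by (apply Rabs_le; lra); nra.
Qed.

(** From cos y - 1 = -2 sin^2 (y/2). The quadratic bound serves [Cexp_quad]; the linear one bounds
    the derivative of sin y - y. *)
Lemma cos_minus_1_bound (y : R) :
  (Rabs (cos y - 1) <= y ^ 2 /\ Rabs (cos y - 1) <= Rabs y)%R.
Proof.
replace (cos y) with (cos (2 * (y / 2))) by (f_equal; field).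
rewrite cos_2a_sin.
pose proof (abs_sin_le (y / 2)) as H; pose proof (SIN_bound (y / 2)) as B.
replace (1 - 2 * sin (y / 2) * sin (y / 2) - 1)%R
  with (- (2 * (sin (y / 2) * sin (y / 2))))%R by ring.
rewrite Rabs_Ropp, Rabs_mult, (Rabs_pos_eq 2), Rabs_mult by lra.
assert (B' : (Rabs (sin (y / 2)) <= 1)%R) by (apply Rabs_le; lra).
unfold Rdiv in H; rewrite Rabs_mult, (Rabs_pos_eq (/ 2)) in H by lra.
replace (y ^ 2)%R with (Rabs y * Rabs y)%R
  by (rewrite <- Rabs_mult, Rabs_pos_eq; [ring|nra]).
pose proof (Rabs_pos y); pose proof (Rabs_pos (sin (y * / 2))).
unfold Rdiv in *; split; nra.
Qed.

Lemma sin_minus_id_bound (y : R) : (Rabs (sin y - y) <= y ^ 2)%R.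
Proof.
destruct (MVT_gen (fun x => sin x - x)%R 0 y (fun x => cos x - 1)%R)
  as [c [Hc H]].
- intros; auto_derive; trivial; ring.
- intros x _; apply derivable_continuous_pt; exists (cos x - 1)%R.
  apply is_derive_Reals; auto_derive; trivial; ring.
- rewrite sin_0, !Rminus_0_r in H; rewrite H, Rabs_mult.
  destruct (cos_minus_1_bound c) as [_ K].
  assert (Hcy : (Rabs c <= Rabs y)%R).
  { unfold Rmin, Rmax in Hc.
    destruct (Rle_dec 0 y); [rewrite !Rabs_pos_eq by lra; lra|].
    rewrite (Rabs_left1 y), (Rabs_left1 c) by lra; lra. }
  replace (y ^ 2)%R with (Rabs y * Rabs y)%R
    by (rewrite <- Rabs_mult, Rabs_pos_eq; [ring|nra]).
  apply Rmult_le_compat_r; [apply Rabs_pos|lra].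
Qed.

Lemma Cmod_le_Re_Im (z : C) : (Cmod z <= Rabs (Re z) + Rabs (Im z))%R.
Proof.
replace z with (RtoC (Re z) + Ci * RtoC (Im z)) at 1
  by (destruct z; apply injective_projections; simpl; ring).
eapply Rle_trans; [apply Cmod_triangle|].
rewrite Cmod_mult, Cmod_Ci, !Cmod_R; lra.
Qed.

(** The real part splits as (e^x - 1 - x) + e^x (cos y - 1), the imaginary part as (e^x - 1) sin y +
    (sin y - y). Each of these four pieces is at most |w|^2 exp |w|, whence the 4. *)
Lemma Cexp_quad (w : C) :
  (Cmod (Cexp w - 1 - w) <= 4 * Cmod w ^ 2 * exp (Cmod w))%R.
Proof.
assert (Hx : (Rabs (Re w) <= Cmod w)%R) by apply re_le_Cmod.
assert (Hy : (Rabs (Im w) <= Cmod w)%R)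
  by (eapply Rle_trans; [|apply Rmax_Cmod]; apply Rmax_r).
set (m := Cmod w) in *.
set (x := Re w) in *; set (y := Im w) in *.
pose proof (exp_minus_1_minus_id_bound x) as E2.
pose proof (exp_minus_1_bound x) as E1.
pose proof (exp_le_compat _ _ Hx) as Ex.
destruct (cos_minus_1_bound y) as [K _].
pose proof (sin_minus_id_bound y) as L.
pose proof (abs_sin_le y) as L1.
assert (m0 : (0 <= m)%R) by apply Cmod_ge_0.
pose proof (exp_ineq1_le m) as Em.
pose proof (exp_le_compat _ _ (Rle_abs x)) as Ex'.
pose proof (exp_pos x) as Ep.
assert (x2 : (x ^ 2 <= m ^ 2)%R).
{ rewrite <- (pow2_abs x); apply pow_incr; split; trivial; apply Rabs_pos. }
assert (y2 : (y ^ 2 <= m ^ 2)%R).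
{ rewrite <- (pow2_abs y); apply pow_incr; split; trivial; apply Rabs_pos. }
pose proof (pow2_ge_0 x); pose proof (pow2_ge_0 y).
eapply Rle_trans; [apply Cmod_le_Re_Im|].
replace (Re (Cexp w - 1 - w)) with ((exp x - 1 - x) + exp x * (cos y - 1))%R
  by (unfold x, y, Cexp, Re, Im; simpl; ring).
replace (Im (Cexp w - 1 - w)) with ((exp x - 1) * sin y + (sin y - y))%R
  by (unfold x, y, Cexp, Re, Im; simpl; ring).
assert (A1 : (Rabs ((exp x - 1 - x) + exp x * (cos y - 1))
  <= 2 * m ^ 2 * exp m)%R).
{ eapply Rle_trans; [apply Rabs_triang|]; rewrite Rabs_mult.
  rewrite (Rabs_pos_eq (exp x)) by lra.
  assert (Rabs (exp x - 1 - x) <= m ^ 2 * exp m)%R.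
  { eapply Rle_trans; [exact E2|]; apply Rmult_le_compat; trivial; lra. }
  assert (exp x * Rabs (cos y - 1) <= exp m * m ^ 2)%R.
  { apply Rmult_le_compat; trivial; try lra; apply Rabs_pos. }
  lra. }
assert (A2 : (Rabs ((exp x - 1) * sin y + (sin y - y))
  <= 2 * m ^ 2 * exp m)%R).
{ eapply Rle_trans; [apply Rabs_triang|]; rewrite Rabs_mult.
  assert (Rabs (exp x - 1) * Rabs (sin y) <= (m * exp m) * m)%R.
  { apply Rmult_le_compat; try apply Rabs_pos; [|lra].
    eapply Rle_trans; [exact E1|].
    apply Rmult_le_compat; trivial; try lra; apply Rabs_pos. }
  assert (m ^ 2 <= m ^ 2 * exp m)%R by nra.
  lra. }
lra.
Qed.

(** The error is b w + (1 + b)(Cexp w - 1 - w), quadratic in x. It isolates the first-order part b +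
    w, in which the 1/n terms of a Gauss factor cancel. *)
Lemma factor_quad (A x : R) (b w : C) :
  (0 <= A)%R -> (0 <= x <= 1)%R -> (Cmod b <= A * x)%R -> (Cmod w <= A * x)%R ->
  (Cmod ((1 + b) * Cexp w - 1 - (b + w)) <=
   (A ^ 2 + (1 + A) * (4 * A ^ 2 * exp A)) * x ^ 2)%R.
Proof.
intros HA Hx Hb Hw.
pose proof (Cmod_ge_0 b) as b0; pose proof (Cmod_ge_0 w) as w0.
replace ((1 + b) * Cexp w - 1 - (b + w)) with
  (b * w + (1 + b) * (Cexp w - 1 - w)) by ring.
eapply Rle_trans; [apply Cmod_triangle|]; rewrite !Cmod_mult.
assert (A0 : (Cmod b <= A /\ Cmod w <= A)%R).
{ split; nra. }
assert (H1 : (Cmod b * Cmod w <= A ^ 2 * x ^ 2)%R).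
{ replace (A ^ 2 * x ^ 2)%R with ((A * x) * (A * x))%R by ring.
  apply Rmult_le_compat; trivial. }
assert (H2 : (Cmod (1 + b) <= 1 + A)%R).
{ eapply Rle_trans; [apply Cmod_triangle|]; rewrite Cmod_1; lra. }
assert (H3 : (Cmod (Cexp w - 1 - w) <= 4 * A ^ 2 * exp A * x ^ 2)%R).
{ eapply Rle_trans; [apply Cexp_quad|].
  replace (4 * A ^ 2 * exp A * x ^ 2)%R with (4 * (A * x) ^ 2 * exp A)%R by ring.
  apply Rmult_le_compat.
  - pose proof (pow2_ge_0 (Cmod w)); lra.
  - left; apply exp_pos.
  - apply Rmult_le_compat_l; [lra|]; now apply pow_incr.
  - now apply exp_le_compat. }
assert (H4 := Rmult_le_compat _ _ _ _ (Cmod_ge_0 _) (Cmod_ge_0 _) H2 H3).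
lra.
Qed.

(** * Increments of the logarithm *)

Lemma ln_0 : ln 0 = 0%R.
Proof. unfold ln; destruct (Rlt_dec 0 0); [exfalso; lra|reflexivity]. Qed.

(* The value at [n = 0] is [0], since [ln 0 = 0]. *)
Definition dln (n : nat) : R := (ln (INR (S n)) - ln (INR n))%R.

Lemma ln_le_minus_1 (x : R) : (0 < x -> ln x <= x - 1)%R.
Proof.
intros Hx; pose proof (exp_ineq1_le (ln x)) as H.
rewrite exp_ln in H by trivial; lra.
Qed.

(** For n >= 1, 1/(n+1) <= [dln n] <= 1/n, by ln y <= y - 1 at y = n/(n+1) and y = (n+1)/n. At n = 0
    the increment is 0 and the second bound reads 1 <= 2. *)
Lemma dln_bound (n : nat) :
  (0 <= dln n <= 2 * / INR (S n) /\
   Rabs (dln n - / INR (S n)) <= 2 * (/ INR (S n)) ^ 2)%R.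
Proof.
unfold dln; destruct n as [|n].
- replace (ln (INR 1)) with 0%R by (simpl; now rewrite ln_1).
  change (INR 0) with 0%R; rewrite ln_0.
  simpl INR; rewrite Rinv_1, Rabs_left by lra; lra.
- pose proof (INR_S_pos n) as P; rewrite (S_INR (S n)).
  assert (P1 : (1 <= INR (S n))%R) by (apply (le_INR 1); lia).
  set (x := INR (S n)) in *.
  assert (L1 : (ln (x + 1) - ln x <= / x)%R).
  { pose proof (ln_le_minus_1 ((x + 1) / x)) as L.
    rewrite ln_div in L by lra.
    replace ((x + 1) / x - 1)%R with (/ x)%R in L by (field; lra).
    apply L, Rdiv_lt_0_compat; lra. }
  assert (L2 : (/ (x + 1) <= ln (x + 1) - ln x)%R).
  { pose proof (ln_le_minus_1 (x / (x + 1))) as L.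
    rewrite ln_div in L by lra.
    replace (x / (x + 1) - 1)%R with (- / (x + 1))%R in L by (field; lra).
    assert (0 < x / (x + 1))%R by (apply Rdiv_lt_0_compat; lra).
    specialize (L H); lra. }
  assert (L3 : (0 < / (x + 1))%R) by (apply Rinv_0_lt_compat; lra).
  assert (L4 : (/ x - / (x + 1) <= 2 * (/ (x + 1)) ^ 2)%R).
  { replace (/ x - / (x + 1))%R with (/ (x * (x + 1)))%R by (field; lra).
    replace (2 * (/ (x + 1)) ^ 2)%R with (/ ((x + 1) * (x + 1) / 2))%R
      by (field; lra).
    apply Rinv_le_contravar; nra. }
  assert (L5 : (/ x <= 2 * / (x + 1))%R).
  { replace (2 * / (x + 1))%R with (/ ((x + 1) / 2))%R by (field; lra).
    apply Rinv_le_contravar; lra. }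
  rewrite Rabs_pos_eq by lra; lra.
Qed.

(** * Uniform distance from the poles *)

Definition regular (z : C) : Prop := forall k : nat, z + RtoC (INR k) <> 0.

(** One constant records both the distance to the poles and the linear growth of |z+k|, so that
    1/(z+k) is O(1/(k+1)) uniformly in k. *)
Definition apart (d : R) (z : C) : Prop :=
  forall k : nat, (d * INR (S k) <= Cmod (z + RtoC (INR k)))%R.

(** Finitely many k are handled by a minimum. From k >= 2|z| + 1 on, |z+k| >= k - |z| >= (k+1)/2, so
    d = 1/2 works there. *)
Lemma regular_apart (z : C) : regular z -> exists d, (0 < d)%R /\ apart d z.
Proof.
intros Hz.
assert (K : forall n, exists d, (0 < d)%R /\ forall k, (k < n)%nat ->
  (d * INR (S k) <= Cmod (z + RtoC (INR k)))%R).
{ induction n as [|n [d [d0 Hd]]].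
  - exists 1%R; split; [lra|]; intros; lia.
  - pose proof (proj1 (Cmod_gt_0 _) (Hz n)) as P.
    pose proof (INR_S_pos n) as Q.
    exists (Rmin d (Cmod (z + RtoC (INR n)) / INR (S n))); split.
    { apply Rmin_pos; trivial; now apply Rdiv_lt_0_compat. }
    intros k Hk; destruct (Nat.eq_dec k n) as [->|Hn].
    + apply Rle_trans with (Cmod (z + RtoC (INR n)) / INR (S n) * INR (S n))%R.
      * apply Rmult_le_compat_r; [lra|apply Rmin_r].
      * right; field; lra.
    + apply Rle_trans with (d * INR (S k))%R; [|apply Hd; lia].
      apply Rmult_le_compat_r; [left; apply INR_S_pos|apply Rmin_l]. }
destruct (INR_unbounded (2 * Cmod z + 1)) as [n Hn].
destruct (K n) as [d [d0 Hd]].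
exists (Rmin d (/ 2)); split; [apply Rmin_pos; lra|].
intros k; destruct (Nat.le_gt_cases n k) as [H|H].
- apply le_INR in H; rewrite S_INR.
  pose proof (Cmod_triangle (z + RtoC (INR k)) (- z)) as T.
  rewrite Cmod_opp in T; replace (z + RtoC (INR k) + - z) with (RtoC (INR k))
    in T by ring.
  rewrite Cmod_R, Rabs_pos_eq in T by apply pos_INR.
  apply Rle_trans with (/ 2 * (INR k + 1))%R.
  + apply Rmult_le_compat_r; [pose proof (pos_INR k); lra|apply Rmin_r].
  + lra.
- apply Rle_trans with (d * INR (S k))%R; [|now apply Hd].
  apply Rmult_le_compat_r; [left; apply INR_S_pos|apply Rmin_l].
Qed.

Lemma apart_regular (d : R) (z : C) : (0 < d)%R -> apart d z -> regular z.
Proof.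
intros d0 Hd k; apply Cmod_gt_0.
eapply Rlt_le_trans; [|apply Hd].
apply Rmult_lt_0_compat; trivial; apply INR_S_pos.
Qed.

(** Since |h| <= d/2 <= (d/2)(k+1), the shift costs at most half of each lower bound; this gives
    constants uniform on a disc. *)
Lemma apart_ball (d : R) (z h : C) :
  apart d z -> (Cmod h <= d / 2)%R -> apart (d / 2) (z + h).
Proof.
intros Hd Hh k; specialize (Hd k).
pose proof (Cmod_triangle (z + h + RtoC (INR k)) (- h)) as T.
rewrite Cmod_opp in T.
replace (z + h + RtoC (INR k) + - h) with (z + RtoC (INR k)) in T by ring.
pose proof (Cmod_ge_0 h).
assert (1 <= INR (S k))%R by (apply (le_INR 1); lia).
nra.
Qed.

Lemma apart_inv (d : R) (z : C) (k : nat) : (0 < d)%R -> apart d z ->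
  (Cmod (/ (z + RtoC (INR k))) <= / d * / INR (S k))%R.
Proof.
intros d0 Hd; pose proof (apart_regular d z d0 Hd k) as R0.
rewrite Cmod_inv, <- Rinv_mult by trivial.
apply Rinv_le_contravar; [|apply Hd].
apply Rmult_lt_0_compat; trivial; apply INR_S_pos.
Qed.

Lemma INR_S_nz (n : nat) : RtoC (INR (S n)) <> 0.
Proof.
intros H; apply RtoC_inj in H; pose proof (INR_S_pos n); lra.
Qed.

Lemma apart_inv_S (d : R) (z : C) (n : nat) : (0 < d)%R -> apart d z ->
  (Cmod (/ (z + RtoC (INR (S n)))) <= / d * / INR (S n))%R.
Proof.
intros d0 Hd; eapply Rle_trans; [now apply (apart_inv d)|].
apply Rmult_le_compat_l; [left; now apply Rinv_0_lt_compat|].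
apply Rinv_le_contravar; [apply INR_S_pos|apply le_INR; lia].
Qed.

(** Both differences from 1/(n+1) are O(1/n^2): 1/(n+1) - 1/(z+n+1) = z/((n+1)(z+n+1)). This one
    cancellation makes the Gauss product, the digamma sequence and its derivative estimate
    converge. *)
Lemma dln_minus_inv_bound (d : R) (z : C) (n : nat) : (0 < d)%R -> apart d z ->
  (Cmod (RtoC (dln n) - / (z + RtoC (INR (S n)))) <=
   (2 + Cmod z * / d) * (/ INR (S n)) ^ 2)%R.
Proof.
intros d0 Hd.
pose proof (apart_regular d z d0 Hd (S n)) as Hz.
pose proof (INR_S_nz n) as Hn; pose proof (inv_INR_S n) as Hx.
replace (RtoC (dln n) - / (z + RtoC (INR (S n)))) with
  (RtoC (dln n - / INR (S n)) +
   z * (/ (z + RtoC (INR (S n))) * RtoC (/ INR (S n)))).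
2:{ rewrite RtoC_minus, RtoC_inv by (pose proof (INR_S_pos n); lra).
    field; now split. }
eapply Rle_trans; [apply Cmod_triangle|].
rewrite !Cmod_mult, !Cmod_R.
destruct (dln_bound n) as [_ B].
pose proof (apart_inv_S d z n d0 Hd) as I.
rewrite (Rabs_pos_eq (/ INR (S n))) by lra.
assert (Cmod z * (Cmod (/ (z + RtoC (INR (S n)))) * / INR (S n)) <=
  Cmod z * (/ d * / INR (S n) * / INR (S n)))%R.
{ apply Rmult_le_compat_l; [apply Cmod_ge_0|].
  apply Rmult_le_compat_r; [lra|exact I]. }
lra.
Qed.

(** * Convergence of the Gauss product to a nonzero limit *)

Lemma rising_nz (z : C) (n : nat) : regular z -> rising z n <> 0.
Proof.
intros Hz; induction n as [|n IH]; simpl; [apply C1_nz|].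
apply Cmult_neq_0; trivial; apply Hz.
Qed.

Lemma fact_nz (n : nat) : RtoC (INR (fact n)) <> 0.
Proof.
intros H; apply RtoC_inj in H; now apply (INR_fact_neq_0 n).
Qed.

Lemma gauss_seq_nz (z : C) (n : nat) : regular z -> gauss_seq z n <> 0.
Proof.
intros Hz; unfold gauss_seq; intros H.
pose proof (rising_nz z (S n) Hz) as HR.
apply (Cmult_neq_0 _ _ (fact_nz n) (Cexp_nz (z * RtoC (ln (INR n))))).
replace (RtoC (INR (fact n)) * Cexp (z * RtoC (ln (INR n)))) with
  (RtoC (INR (fact n)) * Cexp (z * RtoC (ln (INR n))) / rising z (S n)
   * rising z (S n)) by (field; trivial).
rewrite H; ring.
Qed.

(** The factor (n+1)/(z+n+1) is written 1 - z/(z+n+1) to fit [factor_quad]. *)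
Lemma gauss_seq_S (z : C) (n : nat) : regular z ->
  gauss_seq z (S n) = gauss_seq z n *
    ((1 + - z * / (z + RtoC (INR (S n)))) * Cexp (z * RtoC (dln n))).
Proof.
intros Hz; unfold gauss_seq.
replace (z * RtoC (ln (INR (S n)))) with
  (z * RtoC (ln (INR n)) + z * RtoC (dln n))
  by (unfold dln; rewrite RtoC_minus; ring).
rewrite Cexp_plus, fact_simpl, mult_INR, RtoC_mult.
change (rising z (S (S n))) with (rising z (S n) * (z + RtoC (INR (S n)))).
pose proof (rising_nz z (S n) Hz); pose proof (Hz (S n)).
field; now split.
Qed.

(** Consecutive terms have ratio (1 + b) Cexp w, with b and w of order 1/n but b + w of order 1/n^2,
    so the ratio is 1 + O(1/n^2). *)
Lemma gauss_seq_cv (z : C) : regular z ->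
  exists l : C, l <> 0 /\ Clim (gauss_seq z) l.
Proof.
intros Hz; destruct (regular_apart z Hz) as [d [d0 Hd]].
(* Large enough for |z|/d, 2|z| and |z|, the sizes of b and w for the sequence and for its
   reciprocal. *)
set (A := ((Cmod z + 1) * (/ d + 2))%R).
pose proof (Rinv_0_lt_compat d d0) as di; pose proof (Cmod_ge_0 z) as z0.
assert (A0 : (0 <= A)%R) by (unfold A; nra).
set (K := (A ^ 2 + (1 + A) * (4 * A ^ 2 * exp A))%R).
assert (K0 : (0 <= K)%R).
{ unfold K; pose proof (exp_pos A); pose proof (pow2_ge_0 A).
  assert (0 <= 4 * A ^ 2 * exp A)%R by (apply Rmult_le_pos; lra); nra. }
set (c := (K + Cmod z * (2 + Cmod z * / d))%R).
assert (c0 : (0 <= c)%R).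
{ unfold c; assert (0 <= Cmod z * / d)%R by (apply Rmult_le_pos; lra).
  assert (0 <= Cmod z * (2 + Cmod z * / d))%R by (apply Rmult_le_pos; lra); lra. }
assert (Step : forall n b w, (Cmod b <= A * / INR (S n))%R ->
  (Cmod w <= A * / INR (S n))%R ->
  (Cmod (b + w) <= Cmod z * ((2 + Cmod z * / d) * (/ INR (S n)) ^ 2))%R ->
  (Cmod ((1 + b) * Cexp w - 1) <= c * (/ INR (S n)) ^ 2)%R).
{ intros n b w Hb Hw Hbw; pose proof (inv_INR_S n) as Hx.
  assert (Hx' : (0 <= / INR (S n) <= 1)%R) by lra.
  pose proof (factor_quad A _ b w A0 Hx' Hb Hw) as Q; fold K in Q.
  replace ((1 + b) * Cexp w - 1) with
    (((1 + b) * Cexp w - 1 - (b + w)) + (b + w)) by ring.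
  eapply Rle_trans; [apply Cmod_triangle|]; unfold c; lra. }
assert (Hw : forall n, (Cmod z * dln n <= A * / INR (S n))%R).
{ intros n; destruct (dln_bound n) as [[D1 D2] _]; pose proof (inv_INR_S n).
  apply Rle_trans with (Cmod z * (2 * / INR (S n)))%R; [nra|].
  rewrite <- Rmult_assoc; apply Rmult_le_compat_r; [lra|]; unfold A; nra. }
assert (Habs : forall n, Rabs (dln n) = dln n).
{ intros n; apply Rabs_pos_eq, dln_bound. }
destruct (Clim_of_ratio_steps (gauss_seq z) c) as [l Hl]; trivial.
{ intros n; rewrite gauss_seq_S by trivial.
  set (b := - z * / (z + RtoC (INR (S n)))); set (w := z * RtoC (dln n)).
  replace (gauss_seq z n * ((1 + b) * Cexp w) - gauss_seq z n) with
    (((1 + b) * Cexp w - 1) * gauss_seq z n) by ring.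
  rewrite Cmod_mult; apply Rmult_le_compat_r; [apply Cmod_ge_0|].
  apply Step; unfold b, w.
  - rewrite Cmod_mult, Cmod_opp.
    pose proof (apart_inv_S d z n d0 Hd); pose proof (inv_INR_S n).
    apply Rle_trans with (Cmod z * (/ d * / INR (S n)))%R; [nra|].
    rewrite <- Rmult_assoc; apply Rmult_le_compat_r; [lra|]; unfold A; nra.
  - rewrite Cmod_mult, Cmod_R, Habs; apply Hw.
  - replace (- z * / (z + RtoC (INR (S n))) + z * RtoC (dln n)) with
      (z * (RtoC (dln n) - / (z + RtoC (INR (S n))))) by ring.
    rewrite Cmod_mult; apply Rmult_le_compat_l; trivial.
    now apply dln_minus_inv_bound. }
(* The reciprocals converge as well, whence a nonzero limit. *)
destruct (Clim_of_ratio_steps (fun n => / gauss_seq z n) c) as [m Hm]; trivial.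
{ intros n.
  pose proof (Hz (S n)) as Hzn; pose proof (INR_S_nz n) as Hn.
  pose proof (gauss_seq_nz z n Hz) as Gn.
  pose proof (Cexp_nz (z * RtoC (dln n))) as En.
  pose proof (INR_S_pos n) as Pn.
  (* The inverse of (n+1)/(z+n+1) is 1 + z/(n+1), so the reciprocal ratio again has the shape
     treated by [Step]. *)
  assert (E : / gauss_seq z (S n) - / gauss_seq z n =
    ((1 + z * RtoC (/ INR (S n))) * Cexp (- (z * RtoC (dln n))) - 1)
    * / gauss_seq z n).
  { assert (EE : Cexp (- (z * RtoC (dln n))) = / Cexp (z * RtoC (dln n))).
    { assert (P : Cexp (z * RtoC (dln n)) * Cexp (- (z * RtoC (dln n))) = 1).
      { rewrite <- Cexp_plus, <- Cexp_0; f_equal; ring. }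
      replace (Cexp (- (z * RtoC (dln n)))) with
        (/ Cexp (z * RtoC (dln n)) *
         (Cexp (z * RtoC (dln n)) * Cexp (- (z * RtoC (dln n)))))
        by (field; trivial).
      rewrite P; ring. }
    rewrite gauss_seq_S, EE, RtoC_inv by (trivial; lra).
    replace (1 + - z * / (z + RtoC (INR (S n)))) with
      (RtoC (INR (S n)) / (z + RtoC (INR (S n)))) by (field; trivial).
    field; repeat split; trivial. }
  rewrite E, Cmod_mult; apply Rmult_le_compat_r; [apply Cmod_ge_0|].
  apply Step.
  - rewrite Cmod_mult, Cmod_R; pose proof (inv_INR_S n).
    rewrite Rabs_pos_eq by lra.
    apply Rmult_le_compat_r; [lra|]; unfold A; nra.
  - rewrite Cmod_opp, Cmod_mult, Cmod_R, Habs; apply Hw.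
  - replace (z * RtoC (/ INR (S n)) + - (z * RtoC (dln n))) with
      (- (z * RtoC (dln n - / INR (S n)))) by (rewrite RtoC_minus; ring).
    rewrite Cmod_opp, Cmod_mult, Cmod_R; apply Rmult_le_compat_l; trivial.
    eapply Rle_trans; [apply dln_bound|].
    apply Rmult_le_compat_r; [apply pow2_ge_0|].
    assert (0 <= Cmod z * / d)%R by (apply Rmult_le_pos; lra); lra. }
exists l; split; trivial.
intros Hl0; apply C1_nz.
apply (Clim_unique (fun n => gauss_seq z n * / gauss_seq z n)).
- apply (Clim_ext (fun _ => 1)); [|apply Clim_const].
  intros n; now rewrite Cinv_r by now apply gauss_seq_nz.
- replace (RtoC 0) with (l * m) by (rewrite Hl0; ring).
  now apply Clim_mult.
Qed.

Lemma Gamma_Clim (z : C) : regular z ->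
  Clim (gauss_seq z) (Gamma z) /\ Gamma z <> 0.
Proof.
intros Hz; destruct (gauss_seq_cv z Hz) as [l [l0 Hl]].
destruct (Clim_Re_Im _ _ Hl) as [HR HI].
apply is_lim_seq_unique in HR, HI.
replace (Gamma z) with l; [now split|].
unfold Gamma; rewrite HR, HI; destruct l; reflexivity.
Qed.

(** * Digamma as the limit of the logarithmic derivatives of [gauss_seq] *)

Definition psi_seq (z : C) (n : nat) : C :=
  RtoC (ln (INR n)) - csum (fun k => / (z + RtoC (INR k))) n.

Lemma psi_seq_S (z : C) (n : nat) :
  psi_seq z (S n) =
  psi_seq z n + (RtoC (dln n) - / (z + RtoC (INR (S n)))).
Proof.
unfold psi_seq, dln; rewrite csum_S, RtoC_minus; ring.
Qed.

Lemma psi_seq_cv (z : C) : regular z -> exists l, Clim (psi_seq z) l.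
Proof.
intros Hz; destruct (regular_apart z Hz) as [d [d0 Hd]].
apply (Clim_of_inv_sq_steps _ (2 + Cmod z * / d)).
intros n; rewrite psi_seq_S.
set (y := RtoC (dln n) - / (z + RtoC (INR (S n)))).
replace (psi_seq z n + y - psi_seq z n) with y by ring.
now apply dln_minus_inv_bound.
Qed.

(* With D_n = g_n(z+h) / g_n(z), the error e_n = D_n - 1 - h psi_n satisfies
   e_(n+1) - e_n = (D_n - 1) h c_n + D_n r_n, where c_n = psi_(n+1) - psi_n and
   r_n are O(1/n^2) and O(|h|^2/n^2). *)
Lemma gauss_seq_quad (z : C) : regular z ->
  exists r M, (0 < r)%R /\ forall h, (Cmod h < r)%R ->
  regular (z + h) /\ forall n,
  (Cmod (gauss_seq (z + h) n / gauss_seq z n - 1 - h * psi_seq z n)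
   <= M * Cmod h ^ 2)%R.
Proof.
intros Hz; destruct (regular_apart z Hz) as [d [d0 Hd]].
pose proof (Rinv_0_lt_compat d d0) as di; pose proof (Cmod_ge_0 z) as z0.
(* The summand 2/d bounds (n+1)/|z+h+n+1|, as z + h is only d/2-apart; the summand 2 bounds (n+1)
   [dln n]. *)
set (A := (2 * / d + 2)%R).
assert (A0 : (0 <= A)%R) by (unfold A; lra).
set (K := (A ^ 2 + (1 + A) * (4 * A ^ 2 * exp A) + 2 * / d * / d)%R).
assert (K0 : (0 <= K)%R).
{ unfold K; pose proof (exp_pos A); pose proof (pow2_ge_0 A).
  assert (0 <= 4 * A ^ 2 * exp A)%R by (apply Rmult_le_pos; lra); nra. }
set (c := (2 + Cmod z * / d)%R).
assert (c0 : (0 <= c)%R).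
{ unfold c; assert (0 <= Cmod z * / d)%R by (apply Rmult_le_pos; lra); lra. }
set (c1 := (K + c)%R).
assert (c10 : (0 <= c1)%R) by (unfold c1; lra).
set (D0 := (1 + 2 * / d)%R).
set (DB := (D0 * exp (2 * c1))%R).
assert (DB0 : (0 <= DB)%R).
{ unfold DB, D0; pose proof (exp_pos (2 * c1)); nra. }
set (B := (2 * / d + 2 * (c1 * DB))%R).
assert (B0 : (0 <= B)%R) by (unfold B; nra).
exists (Rmin (d / 2) 1), (2 * / d * / d + 2 * (B * c + DB * K))%R.
split; [apply Rmin_pos; lra|].
intros h Hh.
assert (Hh1 : (Cmod h <= 1)%R)
  by (left; eapply Rlt_le_trans; [apply Hh|apply Rmin_r]).
assert (Hhd : apart (d / 2) (z + h)).
{ apply apart_ball; trivial.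
  left; eapply Rlt_le_trans; [apply Hh|apply Rmin_l]. }
assert (d20 : (0 < d / 2)%R) by lra.
pose proof (apart_regular _ _ d20 Hhd) as Hzh.
split; trivial.
pose proof (Cmod_ge_0 h) as h0.
set (D := fun n => gauss_seq (z + h) n / gauss_seq z n).
set (cc := fun n => RtoC (dln n) - / (z + RtoC (INR (S n)))).
set (b := fun n => - h * / (z + h + RtoC (INR (S n)))).
set (w := fun n => h * RtoC (dln n)).
set (rr := fun n => (1 + b n) * Cexp (w n) - 1 - h * cc n).
assert (d2inv : (/ (d / 2) = 2 * / d)%R) by (field; lra).
assert (DS : forall n, D (S n) = D n * ((1 + b n) * Cexp (w n))).
{ intros n; unfold D, b, w; rewrite !gauss_seq_S by trivial.
  replace ((z + h) * RtoC (dln n)) with (z * RtoC (dln n) + h * RtoC (dln n))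
    by ring.
  rewrite Cexp_plus.
  pose proof (gauss_seq_nz z n Hz); pose proof (Cexp_nz (z * RtoC (dln n))).
  pose proof (Hz (S n)); pose proof (Hzh (S n)); pose proof (INR_S_nz n).
  replace (1 + - z * / (z + RtoC (INR (S n)))) with
      (RtoC (INR (S n)) / (z + RtoC (INR (S n)))) by (field; trivial).
  field; repeat split; trivial. }
assert (Hcc : forall n, (Cmod (cc n) <= c * (/ INR (S n)) ^ 2)%R).
{ intros n; now apply dln_minus_inv_bound. }
assert (Hrr : forall n, (Cmod (rr n) <= K * Cmod h ^ 2 * (/ INR (S n)) ^ 2)%R).
{ intros n.
  pose proof (apart_inv_S d z n d0 Hd) as I1.
  pose proof (apart_inv_S _ _ n d20 Hhd) as I2; rewrite d2inv in I2.
  pose proof (inv_INR_S n) as Hx; destruct (dln_bound n) as [[E1 E2] _].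
  pose proof (Hz (S n)); pose proof (Hzh (S n)).
  set (x := (/ INR (S n))%R) in *.
  assert (Hb : (Cmod (b n) <= A * (Cmod h * x))%R).
  { unfold b; rewrite Cmod_mult, Cmod_opp.
    apply Rle_trans with (Cmod h * (2 * / d * x))%R; [nra|].
    replace (A * (Cmod h * x))%R with (Cmod h * (A * x))%R by ring.
    apply Rmult_le_compat_l; trivial; unfold A; nra. }
  assert (Hw : (Cmod (w n) <= A * (Cmod h * x))%R).
  { unfold w; rewrite Cmod_mult, Cmod_R, Rabs_pos_eq by trivial.
    replace (A * (Cmod h * x))%R with (Cmod h * (A * x))%R by ring.
    apply Rmult_le_compat_l; trivial; unfold A; nra. }
  (* Taking |h|/(n+1) as the small parameter of [factor_quad] puts both |h|^2 and 1/n^2 into the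
     error. *)
  assert (Hhx : (0 <= Cmod h * x <= 1)%R) by nra.
  pose proof (factor_quad A _ _ _ A0 Hhx Hb Hw) as Q.
  (* b_n + w_n exceeds h c_n by h^2/((z+n+1)(z+h+n+1)), the origin of the last summand of [K]. *)
  replace (rr n) with (((1 + b n) * Cexp (w n) - 1 - (b n + w n)) +
    h * h * (/ (z + RtoC (INR (S n))) * / (z + h + RtoC (INR (S n)))))
    by (unfold rr, b, w, cc; field; split; trivial).
  eapply Rle_trans; [apply Cmod_triangle|].
  rewrite !Cmod_mult.
  assert (Cmod (/ (z + RtoC (INR (S n)))) * Cmod (/ (z + h + RtoC (INR (S n))))
    <= (/ d * x) * (2 * / d * x))%R
    by (apply Rmult_le_compat; trivial; apply Cmod_ge_0).
  assert (Cmod h * Cmod h * (Cmod (/ (z + RtoC (INR (S n)))) *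
    Cmod (/ (z + h + RtoC (INR (S n))))) <=
    Cmod h * Cmod h * ((/ d * x) * (2 * / d * x)))%R
    by (apply Rmult_le_compat_l; nra).
  unfold K; lra. }
(* Since ln 0 = 0, the index 0 gives 1/z for the Gauss term and -1/z for [psi_seq]; hence D_0 =
   z/(z+h) and e_0 = h^2/(z(z+h)). *)
assert (HD0 : (Cmod (D 0%nat - 1) <= 2 * / d * Cmod h)%R /\
  (Cmod (D 0%nat - 1 - h * psi_seq z 0) <= 2 * / d * / d * Cmod h ^ 2)%R).
{ pose proof (apart_inv d z 0 d0 Hd) as I1.
  pose proof (apart_inv _ _ 0 d20 Hhd) as I2; rewrite d2inv in I2.
  simpl INR in I1, I2; rewrite Rinv_1, Rmult_1_r in I1, I2.
  assert (Z1 : z + 0 <> 0) by apply (Hz 0%nat).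
  assert (Z2 : z + h + 0 <> 0) by apply (Hzh 0%nat).
  assert (L0 : ln (INR 0) = 0%R) by apply ln_0.
  assert (E : D 0%nat = (z + 0) / (z + h + 0)).
  { unfold D, gauss_seq; rewrite L0, !Cmult_0_r, Cexp_0; simpl.
    field; repeat split; trivial; try apply C1_nz.
    all: rewrite ?Cplus_0_r in *; trivial. }
  assert (Ep : psi_seq z 0 = - / (z + 0)).
  { unfold psi_seq; rewrite csum_0, L0; simpl; ring. }
  rewrite E, Ep; split.
  - replace ((z + 0) / (z + h + 0) - 1) with (- (h * / (z + h + 0)))
      by (field; rewrite ?Cplus_0_r in *; trivial).
    rewrite Cmod_opp, Cmod_mult; nra.
  - replace ((z + 0) / (z + h + 0) - 1 - h * - / (z + 0)) with
      (h * h * (/ (z + 0) * / (z + h + 0)))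
      by (field; rewrite ?Cplus_0_r in *; split; trivial).
    rewrite !Cmod_mult.
    assert (Cmod (/ (z + 0)) * Cmod (/ (z + h + 0)) <= (/ d) * (2 * / d))%R
      by (apply Rmult_le_compat; trivial; apply Cmod_ge_0).
    apply Rle_trans with (Cmod h * Cmod h * ((/ d) * (2 * / d)))%R; [|lra].
    apply Rmult_le_compat_l; nra. }
destruct HD0 as [HD0 HE0].
assert (Hstep : forall n, D (S n) - D n = (h * cc n + rr n) * D n).
{ intros n; rewrite DS; unfold rr; ring. }
assert (Hstep' : forall n,
  (Cmod (h * cc n + rr n) <= c1 * Cmod h * (/ INR (S n)) ^ 2)%R).
{ intros n; eapply Rle_trans; [apply Cmod_triangle|]; rewrite Cmod_mult.
  specialize (Hcc n); specialize (Hrr n).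
  pose proof (pow2_ge_0 (/ INR (S n))) as X0.
  assert (Cmod h * Cmod (cc n) <= Cmod h * (c * (/ INR (S n)) ^ 2))%R
    by now apply Rmult_le_compat_l.
  assert (K * Cmod h ^ 2 * (/ INR (S n)) ^ 2 <=
    K * Cmod h * (/ INR (S n)) ^ 2)%R.
  { apply Rmult_le_compat_r; trivial; apply Rmult_le_compat_l; trivial; nra. }
  unfold c1; lra. }
(* The increments of D are relative to D, so a bound uniform in n and h comes first. It makes them
   additive, which yields D_n - 1 = O(|h|) and then the quadratic bound on e_n. *)
assert (HDB : forall n, (Cmod (D n) <= DB)%R).
{ intros n; eapply Rle_trans; [apply (Cmod_le_of_ratio_steps D c1)|]; trivial.
  - intros m; rewrite Hstep, Cmod_mult.
    apply Rmult_le_compat_r; [apply Cmod_ge_0|].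
    eapply Rle_trans; [apply Hstep'|].
    apply Rmult_le_compat_r; [apply pow2_ge_0|]; nra.
  - unfold DB; apply Rmult_le_compat_r; [left; apply exp_pos|].
    replace (D 0%nat) with (1 + (D 0%nat - 1)) by ring.
    eapply Rle_trans; [apply Cmod_triangle|]; rewrite Cmod_1.
    unfold D0; nra. }
assert (HD1 : forall n, (Cmod (D n - 1) <= B * Cmod h)%R).
{ intros n; replace (D n - 1) with ((D n - D 0%nat) + (D 0%nat - 1)) by ring.
  eapply Rle_trans; [apply Cmod_triangle|].
  assert (Cmod (D n - D 0%nat) <= 2 * (c1 * Cmod h * DB))%R.
  { apply (bounded_of_inv_sq_steps D); intros m.
    rewrite Hstep, Cmod_mult.
    replace (c1 * Cmod h * DB * (/ INR (S m)) ^ 2)%R with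
      (c1 * Cmod h * (/ INR (S m)) ^ 2 * DB)%R by ring.
    apply Rmult_le_compat; trivial; apply Cmod_ge_0. }
  unfold B; lra. }
intros n; change (gauss_seq (z + h) n / gauss_seq z n) with (D n).
set (E := fun n => D n - 1 - h * psi_seq z n); change (Cmod (E n) <=
  (2 * / d * / d + 2 * (B * c + DB * K)) * Cmod h ^ 2)%R.
replace (E n) with ((E n - E 0%nat) + E 0%nat) by ring.
eapply Rle_trans; [apply Cmod_triangle|].
assert (Cmod (E n - E 0%nat) <= 2 * ((B * c + DB * K) * Cmod h ^ 2))%R.
{ apply (bounded_of_inv_sq_steps E); intros m.
  replace (E (S m) - E m) with ((D m - 1) * (h * cc m) + rr m * D m).
  2:{ unfold E; rewrite psi_seq_S; fold (cc m).
      replace (D (S m)) with (D m + (D (S m) - D m)) by ring.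
      rewrite Hstep; ring. }
  eapply Rle_trans; [apply Cmod_triangle|]; rewrite !Cmod_mult.
  specialize (Hcc m); specialize (Hrr m); specialize (HDB m);
    specialize (HD1 m).
  assert (Cmod (D m - 1) * (Cmod h * Cmod (cc m)) <=
    (B * Cmod h) * (Cmod h * (c * (/ INR (S m)) ^ 2)))%R.
  { apply Rmult_le_compat; trivial; try apply Cmod_ge_0.
    - apply Rmult_le_pos; apply Cmod_ge_0.
    - now apply Rmult_le_compat_l. }
  assert (Cmod (rr m) * Cmod (D m) <=
    K * Cmod h ^ 2 * (/ INR (S m)) ^ 2 * DB)%R
    by (apply Rmult_le_compat; trivial; apply Cmod_ge_0).
  lra. }
change (Cmod (E 0%nat) <= 2 * / d * / d * Cmod h ^ 2)%R in HE0; lra.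
Qed.

Lemma Clim_bounded (u : nat -> C) (l : C) :
  Clim u l -> exists M, forall n, (Cmod (u n) <= M)%R.
Proof.
intros H.
destruct (filterlim_bounded (K := R_AbsRing) (V := R_NormedModule)
  (fun n => Cmod (u n - l))) as [M HM]; [now exists 0%R|].
exists (M + Cmod l)%R; intros n; specialize (HM n).
replace (u n) with ((u n - l) + l) by ring.
eapply Rle_trans; [apply Cmod_triangle|].
apply Rplus_le_compat_r; eapply Rle_trans; [apply Rle_abs|exact HM].
Qed.

(** Multiplying the relative estimate by [gauss_seq z n], bounded in n because it converges, gives
    the hypothesis of [is_derive_of_Clim] with derivatives [gauss_seq z n * psi_seq z n]. Dividing
    by the nonzero [Gamma z] leaves the limit of [psi_seq z]. *)
Lemma digamma_Clim (z : C) : regular z -> Clim (psi_seq z) (digamma z).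
Proof.
intros Hz; destruct (psi_seq_cv z Hz) as [l Hl].
destruct (Gamma_Clim z Hz) as [HG HG0].
destruct (gauss_seq_quad z Hz) as [r [M [r0 HM]]].
destruct (Clim_bounded _ _ HG) as [N HN].
assert (HD : C_derive Gamma z = Gamma z * l).
{ apply is_C_derive_unique.
  apply (is_derive_of_Clim Gamma (fun n w => gauss_seq w n)
    (fun n => gauss_seq z n * psi_seq z n) z (Gamma z * l) r (N * M)); trivial.
  - intros h Hh; apply Gamma_Clim, HM, Hh.
  - now apply Clim_mult.
  - intros n h Hh; pose proof (gauss_seq_nz z n Hz) as Gn.
    destruct (HM h Hh) as [_ Q]; specialize (Q n).
    replace (gauss_seq (z + h) n - gauss_seq z n -
      h * (gauss_seq z n * psi_seq z n)) with (gauss_seq z n *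
      (gauss_seq (z + h) n / gauss_seq z n - 1 - h * psi_seq z n))
      by (field; trivial).
    rewrite Cmod_mult, Rmult_assoc.
    apply Rmult_le_compat; trivial; apply Cmod_ge_0. }
unfold digamma; rewrite HD.
replace (Gamma z * l / Gamma z) with l by (field; trivial); exact Hl.
Qed.

(** * Power sums and the higher polygamma functions *)

Definition inv_pow_sum (z : C) (m n : nat) : C :=
  csum (fun k => (/ (z + RtoC (INR k))) ^ m) n.

Lemma inv_pow_sum_cv (z : C) (m : nat) : regular z -> (2 <= m)%nat ->
  exists l, Clim (inv_pow_sum z m) l.
Proof.
intros Hz Hm; destruct (regular_apart z Hz) as [d [d0 Hd]].
apply (Clim_of_inv_sq_steps _ ((/ d) ^ m)); intros n.
unfold inv_pow_sum; rewrite csum_S.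
set (S' := csum _ n); set (y := (/ _) ^ m).
replace (S' + y - S') with y by ring; unfold y.
rewrite Cmod_pow.
pose proof (apart_inv_S d z n d0 Hd) as I; pose proof (inv_INR_S n) as Hx.
pose proof (Rinv_0_lt_compat d d0).
apply Rle_trans with ((/ d * / INR (S n)) ^ m)%R.
- apply pow_incr; split; trivial; apply Cmod_ge_0.
- rewrite Rpow_mult_distr; apply Rmult_le_compat_l; [apply pow_le; lra|].
  replace m with (2 + (m - 2))%nat by lia; rewrite pow_add.
  rewrite <- (Rmult_1_r ((/ INR (S n)) ^ 2)) at 2.
  apply Rmult_le_compat_l; [apply pow2_ge_0|].
  rewrite <- (pow1 (m - 2)); apply pow_incr; lra.
Qed.

(* To be used with a = 1/z and b = 1/(z+h). *)
Lemma inv_pow_quad (A x : R) (a b h : C) (m : nat) :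
  (1 <= A)%R -> (0 <= x <= 1)%R ->
  (Cmod a <= A * x)%R -> (Cmod b <= A * x)%R -> b - a = - (h * a * b) ->
  (Cmod (b ^ m - a ^ m + RtoC (INR m) * h * a ^ S m) <=
   INR m ^ 2 * A ^ (m + 2) * (Cmod h ^ 2 * x ^ 2))%R.
Proof.
intros HA Hx Ha Hb E.
pose proof (Cmod_ge_0 a) as a0; pose proof (Cmod_ge_0 b) as b0.
assert (h0 : (0 <= Cmod h ^ 2 * x ^ 2)%R)
  by (apply Rmult_le_pos; apply pow2_ge_0).
induction m as [|m IH].
- simpl; replace (1 - 1 + 0 * h * (a * 1)) with (RtoC 0) by ring.
  rewrite Cmod_0; right; ring.
(* The errors satisfy e_(m+1) = b e_m + (m+1) h^2 a b a^(m+1). The constant m^2 survives because m^2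
   + (m+1) <= (m+1)^2. *)
- set (e := b ^ m - a ^ m + RtoC (INR m) * h * a ^ S m) in *.
  replace (b ^ S m - a ^ S m + RtoC (INR (S m)) * h * a ^ S (S m)) with
    (b * e + RtoC (INR (S m)) * (h * h * (a * b * a ^ S m))).
  2:{ unfold e; rewrite S_INR, RtoC_plus, !Cpow_S.
      transitivity (b * (b ^ m - a ^ m) + RtoC (INR m) * h * b * (a * a ^ m)
        - (RtoC (INR m) + 1) * h * (a * a ^ m) * (- (h * a * b))); [ring|].
      rewrite <- E.
      transitivity (b * b ^ m - a * a ^ m
        + (RtoC (INR m) + 1) * h * (a * (a * a ^ m))
        + a ^ m * ((a - b) - h * a * b)); [ring|].
      replace (a - b) with (- (b - a)) by ring; rewrite E; ring. }
  eapply Rle_trans; [apply Cmod_triangle|].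
  rewrite !Cmod_mult, Cmod_pow, Cmod_R, Rabs_pos_eq by apply pos_INR.
  assert (aA : (Cmod a <= A)%R) by nra.
  assert (bA : (Cmod b <= A)%R) by nra.
  assert (P1 : (Cmod b * Cmod e <=
    A * (INR m ^ 2 * A ^ (m + 2) * (Cmod h ^ 2 * x ^ 2)))%R)
    by (apply Rmult_le_compat; trivial; apply Cmod_ge_0).
  assert (P2 : (Cmod a * Cmod b * Cmod a ^ S m <= A ^ (S m + 2) * x ^ 2)%R).
  { rewrite pow_add.
    replace (A ^ S m * A ^ 2 * x ^ 2)%R with ((A * x) * (A * x) * A ^ S m)%R
      by ring.
    apply Rmult_le_compat; [nra| |nra|apply pow_incr; lra].
    apply pow_le; lra. }
  assert (P3 : (INR (S m) * (Cmod h * Cmod h * (Cmod a * Cmod b * Cmod a ^ S m))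
    <= INR (S m) * (Cmod h ^ 2 * (A ^ (S m + 2) * x ^ 2)))%R).
  { apply Rmult_le_compat_l; [apply pos_INR|].
    replace (Cmod h ^ 2)%R with (Cmod h * Cmod h)%R by ring.
    apply Rmult_le_compat_l; trivial.
    apply Rmult_le_pos; apply Cmod_ge_0. }
  eapply Rle_trans; [apply Rplus_le_compat; [exact P1|exact P3]|].
  rewrite S_INR; change (S m + 2)%nat with (S (m + 2)).
  assert (A2 : (0 <= A ^ (m + 2))%R) by (apply pow_le; lra).
  set (Y := (Cmod h ^ 2 * x ^ 2)%R) in *.
  simpl (A ^ S (m + 2))%R.
  replace (A * (INR m ^ 2 * A ^ (m + 2) * Y) +
    (INR m + 1) * (Cmod h ^ 2 * (A * A ^ (m + 2) * x ^ 2)))%R with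
    ((INR m ^ 2 + INR m + 1) * (A * A ^ (m + 2) * Y))%R by (unfold Y; ring).
  rewrite (Rmult_assoc ((INR m + 1) ^ 2)); apply Rmult_le_compat_r.
  + rewrite Rmult_assoc; apply Rmult_le_pos; [lra|now apply Rmult_le_pos].
  + pose proof (pos_INR m); nra.
Qed.

(** Termwise errors are O(|h|^2/(k+1)^2) even for m = 1, where the sums themselves diverge; that
    case differentiates digamma. *)
Lemma inv_pow_sum_quad (z : C) (m : nat) : regular z ->
  exists r M, (0 < r)%R /\ forall h, (Cmod h < r)%R ->
  regular (z + h) /\ forall n,
  (Cmod (inv_pow_sum (z + h) m n - inv_pow_sum z m n +
     RtoC (INR m) * h * inv_pow_sum z (S m) n) <= M * Cmod h ^ 2)%R.
Proof.
intros Hz; destruct (regular_apart z Hz) as [d [d0 Hd]].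
pose proof (Rinv_0_lt_compat d d0) as di.
set (A := (1 + 2 * / d)%R).
(* The 3 is 1 for the term k = 0 plus 2 for the telescoped rest. *)
exists (d / 2)%R, (3 * (INR m ^ 2 * A ^ (m + 2)))%R; split; [lra|].
intros h Hh.
assert (Hhd : apart (d / 2) (z + h)) by (apply apart_ball; trivial; lra).
assert (d20 : (0 < d / 2)%R) by lra.
pose proof (apart_regular _ _ d20 Hhd) as Hzh; split; trivial.
assert (d2inv : (/ (d / 2) = 2 * / d)%R) by (field; lra).
set (c := (INR m ^ 2 * A ^ (m + 2) * Cmod h ^ 2)%R).
set (a := fun k => / (z + RtoC (INR k))).
set (b := fun k => / (z + h + RtoC (INR k))).
set (e := fun k => b k ^ m - a k ^ m + RtoC (INR m) * h * a k ^ S m).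
assert (He : forall k, (Cmod (e k) <= c * (/ INR (S k)) ^ 2)%R).
{ intros k; pose proof (inv_INR_S k) as Hx.
  pose proof (apart_inv d z k d0 Hd) as I1; fold (a k) in I1.
  pose proof (apart_inv _ _ k d20 Hhd) as I2; rewrite d2inv in I2;
    fold (b k) in I2.
  unfold c; rewrite Rmult_assoc; apply inv_pow_quad.
  - unfold A; lra.
  - lra.
  - eapply Rle_trans; [exact I1|]; apply Rmult_le_compat_r; unfold A; lra.
  - eapply Rle_trans; [exact I2|]; apply Rmult_le_compat_r; unfold A; lra.
  - unfold a, b; pose proof (Hz k); pose proof (Hzh k).
    field; now split. }
intros n.
assert (Es : inv_pow_sum (z + h) m n - inv_pow_sum z m n +
     RtoC (INR m) * h * inv_pow_sum z (S m) n = csum e n).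
{ unfold inv_pow_sum, e; rewrite csum_plus, csum_minus, csum_scal; reflexivity. }
rewrite Es.
assert (B1 : (Cmod (csum e n - csum e 0) <= 2 * c)%R).
{ apply (bounded_of_inv_sq_steps (csum e)); intros k; rewrite csum_S.
  replace (csum e k + e (S k) - csum e k) with (e (S k)) by ring.
  eapply Rle_trans; [apply He|].
  assert (c0 : (0 <= c)%R).
  { specialize (He 0%nat); simpl in He; rewrite Rinv_1 in He.
    pose proof (Cmod_ge_0 (e 0%nat)); lra. }
  apply Rmult_le_compat_l; trivial.
  pose proof (inv_INR_S (S k)).
  apply pow_incr; split; [lra|].
  apply Rinv_le_contravar; [apply INR_S_pos|apply le_INR; lia]. }
assert (B2 : (Cmod (csum e 0) <= c)%R).
{ rewrite csum_0; specialize (He 0%nat); simpl in He; rewrite Rinv_1 in He; lra. }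
replace (csum e n) with ((csum e n - csum e 0) + csum e 0) by ring.
eapply Rle_trans; [apply Cmod_triangle|].
replace (3 * (INR m ^ 2 * A ^ (m + 2)) * Cmod h ^ 2)%R with (2 * c + c)%R
  by (unfold c; ring).
lra.
Qed.

Definition polygamma_coef (k : nat) : R := ((-1) ^ S k * INR (fact k))%R.

(** The logarithm makes the case k = 0 converge; being independent of z, it drops out of all
    differences in z. *)
Definition polygamma_seq (k : nat) (z : C) (n : nat) : C :=
  RtoC (polygamma_coef k) * inv_pow_sum z (S k) n +
  (if Nat.eqb k 0 then RtoC (ln (INR n)) else 0).

(** The induction is over all z at once: differentiating at z needs the previous convergence on a
    disc around z. *)
Lemma polygamma_Clim (k : nat) (z : C) : regular z ->
  Clim (polygamma_seq k z) (polygamma k z).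
Proof.
revert z; induction k as [|k IH]; intros z Hz.
- apply (Clim_ext (psi_seq z)); [|now apply digamma_Clim].
  intros n; unfold polygamma_seq, psi_seq, polygamma_coef, inv_pow_sum.
  simpl Nat.eqb; cbv iota.
  rewrite (csum_ext (fun k => (/ (z + RtoC (INR k))) ^ 1)
    (fun k => / (z + RtoC (INR k)))) by (intros; apply Cpow_1_r).
  replace ((-1) ^ 1 * INR (fact 0))%R with (-1)%R by (simpl; ring); ring.
- destruct (inv_pow_sum_cv z (S (S k)) Hz ltac:(lia)) as [l Hl].
  assert (HG : Clim (polygamma_seq (S k) z) (RtoC (polygamma_coef (S k)) * l)).
  { apply (Clim_ext (fun n => RtoC (polygamma_coef (S k)) *
      inv_pow_sum z (S (S k)) n)); [intros; unfold polygamma_seq; simpl; ring|].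
    now apply Clim_scal. }
  replace (polygamma (S k) z) with (RtoC (polygamma_coef (S k)) * l); trivial.
  symmetry; apply (is_C_derive_unique (polygamma k)).
  destruct (inv_pow_sum_quad z (S k) Hz) as [r [M [r0 HM]]].
  apply (is_derive_of_Clim (polygamma k) (fun n w => polygamma_seq k w n)
    (polygamma_seq (S k) z) z _ r (Rabs (polygamma_coef k) * M)); trivial.
  + intros h Hh; apply IH, HM, Hh.
  + intros n h Hh; destruct (HM h Hh) as [_ Q]; specialize (Q n).
    replace (polygamma_seq k (z + h) n - polygamma_seq k z n -
      h * polygamma_seq (S k) z n) with
      (RtoC (polygamma_coef k) * (inv_pow_sum (z + h) (S k) n -
        inv_pow_sum z (S k) n +
        RtoC (INR (S k)) * h * inv_pow_sum z (S (S k)) n)).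
    * rewrite Cmod_mult, Cmod_R, Rmult_assoc.
      apply Rmult_le_compat_l; trivial; apply Rabs_pos.
    * unfold polygamma_seq.
      replace (polygamma_coef (S k)) with (- (polygamma_coef k * INR (S k)))%R
        by (unfold polygamma_coef; rewrite fact_simpl, mult_INR; simpl pow; ring).
      rewrite RtoC_opp, RtoC_mult; simpl Nat.eqb; cbv iota; ring.
Qed.

(** * Truncated form of the identity *)

Lemma harmonic_0 : harmonic 0 = 0%R.
Proof. unfold harmonic; rewrite sum_n_m_zero by lia; reflexivity. Qed.

Lemma harmonic_S (n : nat) : harmonic (S n) = (harmonic n + / INR (S n))%R.
Proof. unfold harmonic; rewrite sum_n_Sm by lia; reflexivity. Qed.

(** The steps are 1/(n+1) - [dln n], so the limit exists and [Lim_seq] in [euler_gamma] really is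
    that limit. *)
Lemma euler_gamma_Clim :
  Clim (fun n => RtoC (harmonic n - ln (INR n))) (RtoC euler_gamma).
Proof.
destruct (Clim_of_inv_sq_steps (fun n => RtoC (harmonic n - ln (INR n))) 2)
  as [l Hl].
- intros n; rewrite <- RtoC_minus, Cmod_R, harmonic_S.
  replace (harmonic n + / INR (S n) - ln (INR (S n)) -
    (harmonic n - ln (INR n)))%R with (- (dln n - / INR (S n)))%R
    by (unfold dln; ring).
  rewrite Rabs_Ropp; apply dln_bound.
- destruct (Clim_Re_Im _ _ Hl) as [HR HI].
  assert (I0 : Im l = 0%R).
  { apply is_lim_seq_unique in HI.
    rewrite (Lim_seq_ext _ (fun _ => 0%R)), Lim_seq_const in HI by reflexivity.
    now injection HI. }
  apply is_lim_seq_unique in HR.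
  unfold euler_gamma.
  rewrite (Lim_seq_ext _ (fun n => Re (RtoC (harmonic n - ln (INR n)))))
    by reflexivity.
  rewrite HR; simpl real.
  replace (RtoC (Re l)) with l; trivial.
  destruct l; unfold Im in I0; simpl in I0; now rewrite I0.
Qed.

(* The term [m = n] is [/ 0 = 0]. *)
Lemma sum_inv_diff (n N : nat) : (n <= N)%nat ->
  sum_n (fun m => / (INR m - INR n))%R N = (harmonic (N - n) - harmonic n)%R :> R.
Proof.
(* Below n the terms are -1/n, -1/(n-1) and so on. At j = n the truncated n - j - 1 is 0, as at j =
   n - 1, in accordance with the zero term. *)
assert (K : forall j, (j <= n)%nat -> sum_n (fun m => / (INR m - INR n))%R j =
  (harmonic (n - j - 1) - harmonic n)%R :> R).
{ induction j as [|j IH]; intros Hj.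
  - rewrite sum_O; destruct n as [|n].
    + simpl; rewrite Rminus_diag, Rinv_0; ring.
    + replace (S n - 0 - 1)%nat with n by lia; rewrite harmonic_S.
      replace (INR 0 - INR (S n))%R with (- INR (S n))%R by (simpl INR; ring).
      rewrite Rinv_opp; ring.
  - rewrite sum_Sn, IH by lia; change plus with Rplus.
    destruct (Nat.eq_dec (S j) n) as [<-|Hn].
    + rewrite Rminus_diag, Rinv_0.
      replace (S j - j - 1)%nat with 0%nat by lia.
      replace (S j - S j - 1)%nat with 0%nat by lia; ring.
    + replace (n - j - 1)%nat with (S (n - S j - 1)) by lia.
      rewrite harmonic_S.
      replace (INR (S j) - INR n)%R with (- INR (S (n - S j - 1)))%R.
      2:{ replace (S (n - S j - 1)) with (n - S j)%nat by lia.
          rewrite minus_INR by lia; ring. }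
      rewrite Rinv_opp; ring. }
intros H; replace N with (n + (N - n))%nat by lia.
replace (n + (N - n) - n)%nat with (N - n)%nat by lia.
induction (N - n)%nat as [|r IH].
- rewrite Nat.add_0_r, K by lia.
  replace (n - n - 1)%nat with 0%nat by lia; reflexivity.
- replace (n + S r)%nat with (S (n + r)) by lia.
  rewrite sum_Sn, IH, harmonic_S; change plus with Rplus.
  replace (INR (S (n + r)) - INR n)%R with (INR (S r))
    by (rewrite !S_INR, plus_INR; ring).
  ring.
Qed.

(** * Convolution of truncated power sums *)

Lemma csum_geometric (x y : C) (P : nat) :
  (x - y) * csum (fun k => x ^ k * y ^ (P - k)) P = x ^ S P - y ^ S P.
Proof.
induction P as [|P IH].
- rewrite csum_0; simpl; ring.
- rewrite csum_S, Nat.sub_diag.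
  rewrite (csum_ext _ (fun k => y * (x ^ k * y ^ (P - k)))).
  2:{ intros k Hk; replace (S P - k)%nat with (S (P - k)) by lia.
      rewrite Cpow_S; ring. }
  rewrite csum_scal, Cmult_plus_distr_l.
  replace ((x - y) * (y * csum (fun k => x ^ k * y ^ (P - k)) P)) with
    (y * ((x - y) * csum (fun k => x ^ k * y ^ (P - k)) P)) by ring.
  rewrite IH, !Cpow_S; simpl; ring.
Qed.

Lemma csum_mult (a b : nat -> C) (m n : nat) :
  csum a m * csum b n = csum (fun i => csum (fun j => a i * b j) n) m.
Proof.
rewrite <- csum_scal_r; apply csum_ext; intros i _; now rewrite csum_scal.
Qed.

Lemma csum_const (c : C) (n : nat) : csum (fun _ => c) n = RtoC (INR (S n)) * c.
Proof.
induction n as [|n IH].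
- rewrite csum_0; simpl; ring.
- rewrite csum_S, IH, (S_INR (S n)), RtoC_plus; ring.
Qed.

(* Partial fractions: 1/(t+n) - 1/(t+m) = (m-n) / ((t+n)(t+m)). *)
Lemma convolution_pointwise (t : C) (P n m : nat) : regular t ->
  csum (fun k => (/ (t + RtoC (INR n))) ^ S k *
                 (/ (t + RtoC (INR m))) ^ S (P - k)) P =
  ((/ (t + RtoC (INR n))) ^ S P - (/ (t + RtoC (INR m))) ^ S P) *
    RtoC (/ (INR m - INR n)) +
  (if Nat.eqb m n
   then RtoC (INR (S P)) * (/ (t + RtoC (INR m))) ^ S (S P) else 0).
Proof.
intros Ht; pose proof (Ht n) as Hn; pose proof (Ht m) as Hm.
destruct (Nat.eqb_spec m n) as [->|Hmn].
- rewrite Rminus_diag, Rinv_0, Cmult_0_r, Cplus_0_l.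
  rewrite <- csum_const; apply csum_ext; intros k Hk.
  rewrite <- Cpow_add_r; f_equal; lia.
- set (x := / (t + RtoC (INR n))); set (y := / (t + RtoC (INR m))).
  assert (Hd : (INR m - INR n <> 0)%R).
  { intros H; apply Hmn, INR_eq; lra. }
  assert (Hd' : RtoC (INR m - INR n) <> 0).
  { intros H; apply RtoC_inj in H; now apply Hd. }
  assert (Exy : x * y = (x - y) * RtoC (/ (INR m - INR n))).
  { rewrite RtoC_inv by trivial; rewrite RtoC_minus in *.
    unfold x, y; field; repeat split; trivial. }
  rewrite Cplus_0_r, <- csum_geometric.
  replace ((x - y) * csum (fun k => x ^ k * y ^ (P - k)) P *
    RtoC (/ (INR m - INR n))) with
    ((x - y) * RtoC (/ (INR m - INR n)) *
      csum (fun k => x ^ k * y ^ (P - k)) P) by ring.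
  rewrite <- Exy, <- csum_scal; apply csum_ext; intros k _.
  rewrite !Cpow_S; ring.
Qed.

Lemma convolution_inv_pow_sum (t : C) (P N : nat) : regular t ->
  csum (fun k => inv_pow_sum t (S k) N * inv_pow_sum t (S (P - k)) N) P =
  2 * csum (fun n => (/ (t + RtoC (INR n))) ^ S P *
                     RtoC (harmonic (N - n) - harmonic n)) N +
  RtoC (INR (S P)) * inv_pow_sum t (S (S P)) N.
Proof.
intros Ht.
set (a := fun n => / (t + RtoC (INR n))).
set (d := fun n m => RtoC (/ (INR m - INR n))).
assert (E1 : csum (fun k => inv_pow_sum t (S k) N * inv_pow_sum t (S (P - k)) N)
    P = csum (fun n => csum (fun m =>
    (a n ^ S P - a m ^ S P) * d n m +
    (if Nat.eqb m n then RtoC (INR (S P)) * a m ^ S (S P) else 0)) N) N).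
{ unfold inv_pow_sum.
  rewrite (csum_ext _ (fun k => csum (fun n => csum (fun m =>
    a n ^ S k * a m ^ S (P - k)) N) N)) by (intros; apply csum_mult).
  rewrite csum_switch; apply csum_ext; intros n _.
  rewrite csum_switch; apply csum_ext; intros m _.
  now apply convolution_pointwise. }
assert (Ed : forall n, (n <= N)%nat -> csum (fun m => a n ^ S P * d n m) N =
  a n ^ S P * RtoC (harmonic (N - n) - harmonic n)).
{ intros n Hn; rewrite csum_scal; unfold d.
  rewrite csum_RtoC, sum_inv_diff by trivial; reflexivity. }
(* 1/(m-n) is antisymmetric, so exchanging n and m turns this half into minus the other; their
   difference yields the factor 2. *)
assert (E2 : csum (fun n => csum (fun m => a m ^ S P * d n m) N) N =
  - csum (fun n => csum (fun m => a n ^ S P * d n m) N) N).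
{ rewrite csum_switch.
  replace (- csum (fun n => csum (fun m => a n ^ S P * d n m) N) N) with
    ((- (1)) * csum (fun n => csum (fun m => a n ^ S P * d n m) N) N) by ring.
  rewrite <- csum_scal; apply csum_ext; intros m _.
  rewrite <- csum_scal; apply csum_ext; intros n _.
  unfold d; replace (INR m - INR n)%R with (- (INR n - INR m))%R by ring.
  rewrite Rinv_opp, RtoC_opp; ring. }
rewrite E1.
rewrite (csum_ext _ (fun n => (csum (fun m => a n ^ S P * d n m) N -
  csum (fun m => a m ^ S P * d n m) N) + RtoC (INR (S P)) * a n ^ S (S P))).
2:{ intros n Hn; rewrite csum_plus; f_equal.
    - rewrite <- csum_minus; apply csum_ext; intros; ring.
    - now rewrite (csum_delta (fun m => RtoC (INR (S P)) * a m ^ S (S P))). }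
rewrite csum_plus, csum_minus, E2, csum_scal.
rewrite (csum_ext (fun n => csum (fun m => a n ^ S P * d n m) N) _ N Ed).
unfold inv_pow_sum, a; ring.
Qed.

(** The factorials cancel against the binomial coefficient and the sign no longer depends on k: this
    turns the weighted convolution in [T] into the unweighted one of power sums. *)
Lemma polygamma_coef_binomial (P k : nat) : (k <= P)%nat ->
  (Binomial.C P k * polygamma_coef k * polygamma_coef (P - k) =
   - polygamma_coef P)%R.
Proof.
intros Hk; unfold Binomial.C, polygamma_coef.
replace ((-1) ^ S P)%R with (- ((-1) ^ k * (-1) ^ (P - k)))%R.
2:{ rewrite <- pow_add; replace (k + (P - k))%nat with P by lia; simpl; ring. }
simpl pow; field; split; apply INR_fact_neq_0.
Qed.

(** The logarithm occurs only in the factors of order 0, at k = 0 and k = P. These are distinct for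
    P >= 1, so no squared logarithm arises and each contributes ln N times S_(P+1). *)
Lemma binomial_convolution_polygamma_seq (t : C) (P N : nat) : (1 <= P)%nat ->
  csum (fun k => RtoC (Binomial.C P k) * polygamma_seq k t N *
                 polygamma_seq (P - k) t N) P =
  - RtoC (polygamma_coef P) *
  (csum (fun k => inv_pow_sum t (S k) N * inv_pow_sum t (S (P - k)) N) P -
   2 * RtoC (ln (INR N)) * inv_pow_sum t (S P) N).
Proof.
intros HP.
set (S' := fun k => inv_pow_sum t (S k) N).
set (L := RtoC (ln (INR N))).
rewrite (csum_ext _ (fun k => - RtoC (polygamma_coef P) *
  (S' k * S' (P - k)%nat -
   ((if Nat.eqb k 0 then L * S' (P - k)%nat else 0) +
    (if Nat.eqb k P then L * S' k else 0))))).
2:{ intros k Hk.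
    rewrite <- RtoC_opp, <- (polygamma_coef_binomial P k Hk), !RtoC_mult.
    unfold polygamma_seq; fold (S' k) (S' (P - k)%nat) L.
    destruct (Nat.eqb_spec k 0) as [->|H0].
    - replace (Nat.eqb (P - 0) 0) with false
        by (symmetry; apply Nat.eqb_neq; lia).
      replace (Nat.eqb 0 P) with false by (symmetry; apply Nat.eqb_neq; lia).
      replace (polygamma_coef 0) with (- (1))%R
        by (unfold polygamma_coef; simpl; ring).
      rewrite RtoC_opp; ring.
    - destruct (Nat.eqb_spec k P) as [->|H1].
      + rewrite Nat.sub_diag; simpl Nat.eqb; cbv iota.
        replace (polygamma_coef 0) with (- (1))%R
          by (unfold polygamma_coef; simpl; ring).
        rewrite RtoC_opp; ring.
      + replace (Nat.eqb (P - k) 0) with false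
          by (symmetry; apply Nat.eqb_neq; lia).
        ring. }
rewrite csum_scal, csum_minus, csum_plus.
rewrite (csum_delta (fun k => L * S' (P - k)%nat)) by lia.
rewrite (csum_delta (fun k => L * S' k)) by lia.
rewrite Nat.sub_0_r; unfold S'; ring.
Qed.

(** The logarithm paired with H_N cancels those of the convolution, the diagonal m = n cancels
    [polygamma_seq (S P)], and H_N S_(P+1) joins the terms in H_(N-n) to form the remainder. *)
Lemma T_truncation (t : C) (P N : nat) : regular t -> (1 <= P)%nat ->
  RtoC ((-1) ^ P / (2 * INR (fact P))) *
  (polygamma_seq (S P) t N
   - RtoC (2 * (harmonic N - ln (INR N))) * polygamma_seq P t N
   - csum (fun k => RtoC (Binomial.C P k) * polygamma_seq k t N *
                    polygamma_seq (P - k) t N) P) =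
  csum (fun n => RtoC (harmonic n) * (/ (t + RtoC (INR n))) ^ S P) N +
  csum (fun n => RtoC (harmonic N - harmonic (N - n)) *
                 (/ (t + RtoC (INR n))) ^ S P) N.
Proof.
intros Ht HP.
rewrite binomial_convolution_polygamma_seq, convolution_inv_pow_sum by trivial.
set (A := csum (fun n => RtoC (harmonic n) * (/ (t + RtoC (INR n))) ^ S P) N).
set (B := csum (fun n => RtoC (harmonic (N - n)) * (/ (t + RtoC (INR n))) ^ S P) N).
assert (E1 : csum (fun n => (/ (t + RtoC (INR n))) ^ S P * RtoC (harmonic (N - n) - harmonic n)) N
  = B - A).
{ unfold A, B; rewrite <- csum_minus; apply csum_ext; intros n _.
  rewrite RtoC_minus; ring. }
assert (E2 : csum (fun n => RtoC (harmonic N - harmonic (N - n)) * (/ (t + RtoC (INR n))) ^ S P) N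
  = RtoC (harmonic N) * inv_pow_sum t (S P) N - B).
{ unfold B, inv_pow_sum; rewrite <- csum_scal, <- csum_minus.
  apply csum_ext; intros n _; rewrite RtoC_minus; ring. }
rewrite E1, E2.
unfold polygamma_seq.
replace (Nat.eqb P 0) with false by (symmetry; apply Nat.eqb_neq; lia).
simpl Nat.eqb; cbv iota.
replace (polygamma_coef (S P)) with (- (polygamma_coef P * INR (S P)))%R
  by (unfold polygamma_coef; rewrite fact_simpl, mult_INR; simpl pow; ring).
assert (Ec : RtoC ((-1) ^ P / (2 * INR (fact P))) * RtoC (polygamma_coef P)
  = RtoC (- / 2)).
{ rewrite <- RtoC_mult; f_equal; unfold polygamma_coef.
  assert (E : ((-1) ^ P * (-1) ^ P = 1)%R).
  { rewrite <- Rpow_mult_distr; replace (-1 * -1)%R with 1%R by ring.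
    apply pow1. }
  transitivity (- ((-1) ^ P * (-1) ^ P) / 2)%R;
    [simpl pow; field; apply INR_fact_neq_0|rewrite E; lra]. }
rewrite RtoC_opp, RtoC_inv in Ec by lra.
rewrite !RtoC_opp, !RtoC_mult, RtoC_minus.
set (c := RtoC ((-1) ^ P / (2 * INR (fact P)))) in *.
set (q := RtoC (polygamma_coef P)) in *.
set (L := RtoC (ln (INR N))).
set (Hn := RtoC (harmonic N)).
set (X := inv_pow_sum t (S P) N).
set (Y := inv_pow_sum t (S (S P)) N).
set (p := RtoC (INR (S P))).
transitivity (c * q * (- (p * Y) - 2 * (Hn - L) * X +
  (2 * (B - A) + p * Y - 2 * L * X))); [ring|].
rewrite Ec; field.
Qed.

(** * Vanishing of the remainder *)

Lemma sum_n_rev (f : nat -> R) (N : nat) :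
  sum_n (fun n => f (N - n)%nat) N = sum_n f N :> R.
Proof.
induction N as [|N IH]; [now rewrite !sum_O|].
rewrite (sum_Sn f), <- IH; unfold sum_n at 1.
rewrite sum_Sn_m, <- sum_n_m_S by lia.
rewrite Nat.sub_0_r; change plus with Rplus; rewrite Rplus_comm.
reflexivity.
Qed.

(** H_N / N is the Cesaro mean of the null sequence 1/n. *)
Lemma harmonic_mean_lim :
  is_lim_seq (fun N => harmonic (S N) / INR (S N))%R 0.
Proof.
assert (H0 : Un_cv (fun n => / INR (S n))%R 0).
{ apply is_lim_seq_Reals.
  apply (is_lim_seq_incr_1 (fun n => / INR n)%R).
  replace (Finite 0) with (Rbar_inv p_infty) by reflexivity.
  apply is_lim_seq_inv; [apply is_lim_seq_INR|discriminate]. }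
apply Cesaro_1 in H0; apply is_lim_seq_Reals in H0.
apply (is_lim_seq_incr_1 _ _) in H0.
eapply is_lim_seq_ext; [|exact H0].
intros N; cbv beta; simpl pred.
rewrite <- sum_n_Reals; f_equal; unfold harmonic, sum_n; now rewrite <- sum_n_m_S.
Qed.

Lemma harmonic_diff_bound (N n : nat) : (n <= N)%nat ->
  (0 <= harmonic N - harmonic (N - n) <= INR n * / INR (S (N - n)))%R.
Proof.
intros H; replace (harmonic N) with (harmonic ((N - n) + n)) by (f_equal; lia).
generalize (N - n)%nat as r; intros r.
induction n as [|n IH].
- rewrite Nat.add_0_r; simpl; lra.
- rewrite Nat.add_succ_r, harmonic_S, (S_INR n).
  specialize (IH ltac:(lia)).
  pose proof (inv_INR_S (r + n)).
  assert (/ INR (S (r + n)) <= / INR (S r))%R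
    by (apply Rinv_le_contravar; [apply INR_S_pos|apply le_INR; lia]).
  lra.
Qed.

(** With u = n+1 and v = N-n+1, a term is at most a constant times (u-1)/(v u^2), hence 1/(uv).
    Partial fractions, 1/(uv) = (1/u + 1/v)/(u+v), then give two harmonic sums divided by about
    N. *)
Lemma remainder_Clim (t : C) (P : nat) : regular t -> (1 <= P)%nat ->
  Clim (fun N => csum (fun n => RtoC (harmonic N - harmonic (N - n)) *
                 (/ (t + RtoC (INR n))) ^ S P) N) 0.
Proof.
intros Ht HP; destruct (regular_apart t Ht) as [d [d0 Hd]].
pose proof (Rinv_0_lt_compat d d0) as di.
apply (Clim_squeeze _ _
  (fun N => (/ d) ^ S P * 2 * (harmonic (S N) / INR (S N)))%R).
2:{ replace (Finite 0) with (Finite ((/ d) ^ S P * 2 * 0)) by (f_equal; ring).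
    apply is_lim_seq_mult'; [apply is_lim_seq_const|apply harmonic_mean_lim]. }
intros N; unfold Cminus; rewrite Copp_0, Cplus_0_r.
apply Rle_trans with (sum_n (fun n => (/ d) ^ S P * / INR (S N) *
  (/ INR (S n) + / INR (S (N - n))))%R N).
- apply Cmod_csum_le; intros n Hn.
  rewrite Cmod_mult, Cmod_R, Cmod_pow.
  destruct (harmonic_diff_bound N n Hn) as [D1 D2].
  rewrite Rabs_pos_eq by trivial.
  pose proof (apart_inv d t n d0 Hd) as I.
  pose proof (inv_INR_S n) as Hx; pose proof (inv_INR_S (N - n)) as Hy.
  assert (I2 : (Cmod (/ (t + RtoC (INR n))) ^ S P <=
    (/ d) ^ S P * (/ INR (S n)) ^ 2)%R).
  { eapply Rle_trans;
      [apply pow_incr; split; [apply Cmod_ge_0|exact I]|].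
    rewrite Rpow_mult_distr; apply Rmult_le_compat_l; [apply pow_le; lra|].
    replace (S P) with (2 + (P - 1))%nat by lia; rewrite pow_add.
    rewrite <- (Rmult_1_r ((/ INR (S n)) ^ 2)) at 2.
    apply Rmult_le_compat_l; [apply pow2_ge_0|].
    rewrite <- (pow1 (P - 1)); apply pow_incr; lra. }
  eapply Rle_trans.
  { apply Rmult_le_compat; [trivial| |exact D2|exact I2].
    apply pow_le, Cmod_ge_0. }
  assert (dP : (0 <= (/ d) ^ S P)%R) by (apply pow_le; lra).
  set (K := ((/ d) ^ S P)%R) in *.
  pose proof (INR_S_pos n) as P1; pose proof (INR_S_pos (N - n)) as P2.
  assert (ES : INR (S N) = (INR (S n) + INR (S (N - n)) - 1)%R).
  { rewrite <- plus_INR; replace (S n + S (N - n))%nat with (S (S N)) by lia.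
    rewrite (S_INR (S N)); ring. }
  assert (P3 : (1 <= INR (S n))%R) by (apply (le_INR 1); lia).
  assert (P4 : (1 <= INR (S (N - n)))%R) by (apply (le_INR 1); lia).
  assert (EN : INR n = (INR (S n) - 1)%R) by (rewrite S_INR; ring).
  rewrite ES, EN; set (u := INR (S n)) in *; set (v := INR (S (N - n))) in *.
  (* Here N + 1 = u + v - 1, so after extracting 1/(uv) it remains that (u-1)/u <= 1 <=
     (u+v)/(u+v-1). *)
  replace ((u - 1) * / v * (K * (/ u) ^ 2))%R with
    (K * (/ (u * v) * ((u - 1) / u)))%R by (field; lra).
  replace (K * / (u + v - 1) * (/ u + / v))%R with
    (K * (/ (u * v) * ((u + v) / (u + v - 1))))%R by (field; lra).
  apply Rmult_le_compat_l; trivial.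
  apply Rmult_le_compat_l; [left; apply Rinv_0_lt_compat; nra|].
  apply Rle_trans with 1%R.
  + apply (Rmult_le_reg_r u); trivial.
    replace ((u - 1) / u * u)%R with (u - 1)%R by (field; lra); lra.
  + apply (Rmult_le_reg_r (u + v - 1)); [lra|].
    replace ((u + v) / (u + v - 1) * (u + v - 1))%R with (u + v)%R
      by (field; lra); lra.
- right.
  assert (Hs : sum_n (fun n => / INR (S n))%R N = harmonic (S N) :> R)
    by (unfold harmonic, sum_n; now rewrite <- sum_n_m_S).
  transitivity ((/ d) ^ S P * / INR (S N) *
    (sum_n (fun n => / INR (S n))%R N +
     sum_n (fun n => / INR (S (N - n)))%R N))%R.
  + rewrite (sum_n_mult_l (K := R_Ring)).
    rewrite (sum_n_plus (G := R_AbelianGroup) (fun n => / INR (S n))%R).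
    reflexivity.
  + rewrite (sum_n_rev (fun n => / INR (S n))%R), Hs; unfold Rdiv; ring.
Qed.

(** * Passage to the limit *)

Lemma regular_of_nonint (t : C) :
  (forall m : Z, t <> RtoC (IZR m)) -> regular t.
Proof.
intros H k Hk; apply (H (- Z.of_nat k)%Z).
rewrite opp_IZR, <- INR_IZR_INZ, RtoC_opp.
replace t with ((t + RtoC (INR k)) + - RtoC (INR k)) by ring.
rewrite Hk; ring.
Qed.

Theorem theorem2 (p : nat) (t : C)
    (hp : (2 <= p)%nat)
    (ht : forall m : Z, t <> RtoC (IZR m)) :
  is_series (K := C_AbsRing) (V := C_NormedModule)
    (fun n : nat =>
       RtoC (harmonic (S n)) / Cpow (RtoC (INR (S n)) + t) p)
    (T t p).
Proof.
apply is_series_Clim.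
apply regular_of_nonint in ht.
destruct p as [|P]; [lia|]; assert (HP : (1 <= P)%nat) by lia.
set (f := fun n => RtoC (harmonic n) * (/ (t + RtoC (INR n))) ^ S P).
(* The series starts at k = 1, the truncated identity at n = 0; the extra term vanishes because H_0
   = 0. *)
apply (Clim_ext (fun N => csum f (S N))).
{ induction n as [|n IH].
  - rewrite csum_S, !csum_0; unfold f; rewrite harmonic_0.
    rewrite (Cplus_comm _ t), (Cpow_inv (t + RtoC (INR 1))) by apply ht.
    unfold Cdiv; ring.
  - rewrite csum_S, IH, csum_S; f_equal; unfold f.
    rewrite (Cplus_comm _ t), Cpow_inv by apply ht; reflexivity. }
apply (Clim_incr_1 (csum f)).
unfold T; replace (S P - 1)%nat with P by lia.
set (R0 := fun N => csum (fun n => RtoC (harmonic N - harmonic (N - n)) *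
  (/ (t + RtoC (INR n))) ^ S P) N).
apply (Clim_ext (fun N => RtoC ((-1) ^ P / (2 * INR (fact P))) *
  (polygamma_seq (S P) t N
   - RtoC (2 * (harmonic N - ln (INR N))) * polygamma_seq P t N
   - csum (fun k => RtoC (Binomial.C P k) * polygamma_seq k t N *
                    polygamma_seq (P - k) t N) P) - R0 N)).
{ intros N; rewrite T_truncation by trivial; unfold R0, f; ring. }
(* The target is written as itself minus 0, the limit of the remainder, to fit [Clim_minus]. *)
assert (M0 : forall z : C, z - 0 = z) by (intros; ring).
match goal with |- Clim _ ?l => rewrite <- (M0 l) end.
apply Clim_minus; [|now apply remainder_Clim].
apply Clim_scal, Clim_minus; [apply Clim_minus|].
- now apply polygamma_Clim.
- apply Clim_mult; [|now apply polygamma_Clim].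
  apply (Clim_ext (fun N => RtoC 2 * RtoC (harmonic N - ln (INR N)))).
  + intros N; now rewrite RtoC_mult.
  + rewrite RtoC_mult; apply Clim_scal, euler_gamma_Clim.
- apply (Clim_csum (fun N k => RtoC (Binomial.C P k) * polygamma_seq k t N *
    polygamma_seq (P - k) t N)).
  intros k _; apply Clim_mult; [apply Clim_scal|]; now apply polygamma_Clim.
Qed.
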